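(* Let $d_1<d_2<\cdots<d_N$ be positive integers. If $$\max\{d_{j+1}-d_j : 1\le j\le N-1\}\le 2,$$ then there exists a recurrent process $\{S_k\}$ with independent increments which interlaces infinitely many $d_j$-dimensional steps for each $j$. More precisely, $S_{k+1}-S_k$ has a truly $D(k)$-dimensional distribution for each $k$, and the sequence $\{D(k)\}$ takes on only the values $d_1,\dots,d_N$, each one infinitely often. If the displayed condition is violated, then any such process $\{S_k\}$ must be transient.
   Context: The processes considered are random walks in varying dimension. There is a truly $d_N$-dimensional distribution $F$ on $\mathbb{Z}^{d_N}$ with mean zero and finite variance, under which the $d_N$ coordinates are independent. The process $\{S_k\}$ in $\mathbb{Z}^{d_N}$ starts at $0$ and has independent increments, and $S_{k+1}-S_k$ is distributed as the projection of $F$ to the first $D(k)$ coordinates (the remaining coordinates of the increment being $0$), where $\{D(k)\}$ is a deterministic sequence with values in $\{d_1,\dots,d_N\}$. A distribution on $\mathbb{Z}^m$ is truly $m$-dimensional if it is not supported on a proper linear subspace of $\mathbb{R}^m$. The process is recurrent if the number of $k$ with $S_k=0$ is almost surely infinite, and transient if this number is almost surely finite.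
   Formalization: The existence claim is proved under the extra hypothesis d_1 ≤ 2; for d_1 ≥ 3 it is false, since the first three coordinates then form a transient walk with i.i.d. steps (e.g. N = 1, d_1 = 3). *)

(* Defs.v *)
From HB Require Import structures.
From mathcomp Require Import all_boot all_order all_algebra.
From mathcomp Require Import all_classical all_reals all_analysis.

Set Implicit Arguments.
Unset Strict Implicit.
Unset Printing Implicit Defensive.

Import Order.TTheory GRing.Theory Num.Theory.
Local Open Scope classical_set_scope.
Local Open Scope ring_scope.

(* Z^m, with the discrete sigma-algebra *)
Definition lattice (m : nat) : Type := 'rV[int]_m.
HB.instance Definition _ (m : nat) := GRing.Zmodule.on (lattice m).
HB.instance Definition _ (m : nat) := isPointed.Build (lattice m) 0.
HB.instance Definition _ (m : nat) :=
  @isMeasurable.Build default_measure_display (lattice m)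
    discrete_measurable discrete_measurable0
    discrete_measurableC discrete_measurableU.

(* For n <= m this is the projection of Z^m onto its first n coordinates; for
   m <= n it is the inclusion of Z^m in Z^n that sets the new coordinates to 0 *)
Definition first_coords (m n : nat) (z : lattice m) : lattice n :=
  \row_(i < n) oapp (fun j : 'I_m => z 0 j) 0 (insub (val i)).

Definition coord (R : realType) (m : nat) (i : 'I_m) (z : lattice m) : R :=
  (z 0 i)%:~R.

Definition truly_dimensional (R : realType) (n : nat)
    (mu : set (lattice n) -> \bar R) : Prop :=
  forall V : {vspace 'rV[R]_n},
    mu [set z | map_mx intr (z : 'rV[int]_n) \notin V] = 0%E -> V = fullv.

Definition mutually_independent (d d' : measure_display)
    (T : measurableType d) (T' : measurableType d') (R : realType)
    (P : probability T R) (I : eqType) (X : I -> T -> T') : Prop :=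
  forall (J : seq I) (A : I -> set T'),
    uniq J -> (forall i, measurable (A i)) ->
    P (\bigcap_(i in [set` J]) X i @^-1` A i)
    = (\prod_(i <- J) P (X i @^-1` A i))%E.

Record step_distribution (R : realType) (m : nat)
    (F : probability (lattice m) R) : Prop := StepDistribution {
  step_truly : truly_dimensional F;
  step_indep : mutually_independent F (@coord R m);
  step_integrable : forall i : 'I_m, F.-integrable setT (EFin \o coord R i);
  step_mean0 : forall i : 'I_m, ('E_F[coord R i] = 0)%E;
  step_variance : forall i : 'I_m, ('V_F[coord R i] < +oo)%E }.

Section Walk.
Context (R : realType) (d : measure_display) (T : measurableType d)
  (P : probability T R) (m : nat).
Implicit Types S : nat -> {RV P >-> lattice m}.

Definition increment S (k : nat) (t : T) : lattice m := S k.+1 t - S k t.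

Record walk_in_varying_dimension (F : probability (lattice m) R)
    (D : nat -> nat) S : Prop := WalkInVaryingDimension {
  walk_start : forall t, S 0%N t = 0;
  walk_indep : mutually_independent P (increment S);
  walk_step : forall k (A : set (lattice m)),
    pushforward P (increment S k) A
    = pushforward F (@first_coords (D k) m \o @first_coords m (D k)) A }.

Record interlaces (N : nat) (dim : nat -> nat) (D : nat -> nat) S : Prop :=
  Interlaces {
  interlaces_truly : forall k,
    truly_dimensional
      (pushforward P (@first_coords m (D k) \o increment S k));
  interlaces_values : forall k, exists2 j, (1 <= j <= N)%N & D k = dim j;
  interlaces_infinitely_often : forall j, (1 <= j <= N)%N ->
    infinite_set [set k | D k = dim j] }.

Definition recurrent S : Prop :=
  {ae P, forall t, infinite_set [set k | S k t = 0]}.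

Definition transient S : Prop :=
  {ae P, forall t, finite_set [set k | S k t = 0]}.

End Walk.

(* Main.v *)
Require Import Defs.
From HB Require Import structures.
From mathcomp Require Import all_boot all_order all_algebra.
From mathcomp Require Import all_classical all_reals all_analysis.
From mathcomp Require Import ring lra zify.

(** Both halves rest on the same remark: as the coordinates of a step are
    independent, the probability that a set of coordinates is back at 0 is the
    product of the probabilities for the single coordinates
    ([coordinate_sums]), and after n effective steps each factor is of order
    n^(-1/2), or less.

    Large gap. If dim j.+1 - dim j >= 3, the three coordinates dim j, dim j + 1,
    dim j + 2 are moved by exactly the same steps, those of dimension above
    dim j, and there are infinitely many of them. After n of these steps the
    three coordinates are all 0 with probability at most a constant times
    n^(-3/2). The upper bound on each factor is a Littlewood-Offord inequality
    ([concentration]), for which it is enough that the coordinate takes two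
    different values with positive probability. By Borel-Cantelli the three
    coordinates are all 0 for only finitely many n, and to each n correspond
    finitely many times ([transient_of_gap]).

    Small gaps. The coordinates are cut into N groups of at most two, group j
    holding the coordinates from dim j (from 0 if j = 0) up to dim j.+1. All
    steps are vectors of fair signs. Group 0 moves at every step, and each
    following group moves much more rarely than the one before: it makes one
    step whenever the preceding group, in its own time, passes one of the times
    t 1 < t 2 < ... . A walk with signs in at most two dimensions has a
    divergent expected number of returns to 0, hence is recurrent, and a
    last-exit decomposition makes this quantitative ([avoids_prob],
    [return_window]): the t n can be so chosen that a group misses 0 during
    [t n, t n.+1) with probability at most 2^-n. By Borel-Cantelli every
    group is at 0 at some time of each window [t n, t n.+1) of its own time,
    for n large. A time n of a group is a whole window of the preceding
    group. Descending from the last group to the first one, one finds a zero of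
    each group within the period during which the groups above stand still
    at 0, and so arbitrarily late times at which all coordinates vanish
    ([common_zero]). No independence between groups is used. The signs come from
    the binary digits of a uniform point of the unit interval. *)

Set Implicit Arguments.
Unset Strict Implicit.
Unset Printing Implicit Defensive.

Import Order.TTheory GRing.Theory Num.Theory.
Local Open Scope classical_set_scope.
Local Open Scope ring_scope.

(** * Independent countably valued variables *)

Section Independence.
Context (R : realType) (d : measure_display) (T : measurableType d).
Variable P : probability T R.

(** Real-valued, so that products and finite sums of probabilities are plain
    field expressions. *)
Definition pr (A : set T) : R := fine (P A).

Lemma prE A : measurable A -> P A = (pr A)%:E.
Proof. by move=> mA; rewrite /pr fineK// fin_num_measure. Qed.

Lemma pr_ge0 A : 0 <= pr A.
Proof. by rewrite fine_ge0. Qed.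

Lemma prT : pr setT = 1.
Proof. by rewrite /pr probability_setT. Qed.

Lemma pr0 : pr set0 = 0.
Proof. by rewrite /pr measure0. Qed.

Lemma le_pr A B : measurable A -> measurable B -> A `<=` B -> pr A <= pr B.
Proof.
move=> mA mB AB; rewrite -lee_fin -!prE//.
by apply: le_measure => //; rewrite inE.
Qed.

Lemma pr_le1 A : measurable A -> pr A <= 1.
Proof. by move=> mA; rewrite -prT; apply: le_pr. Qed.

Lemma prU A B : measurable A -> measurable B -> A `&` B = set0 ->
  pr (A `|` B) = pr A + pr B.
Proof.
move=> mA mB AB; apply: EFin_inj; rewrite EFinD -!prE//; last exact: measurableU.
exact: measureU.
Qed.

Lemma prC A : measurable A -> pr (~` A) = 1 - pr A.
Proof.
move=> mA; rewrite -prT -(setvU A) prU//; first by rewrite addrK.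
  exact: measurableC.
by rewrite setIC setICr.
Qed.

(** The form in which the measurability of a countably valued variable is
    used: every set of values is an event. *)
Definition discrete (V : Type) (X : T -> V) :=
  forall A : set V, measurable (X @^-1` A).

Lemma discrete_comp (V W : Type) (f : V -> W) (X : T -> V) :
  discrete X -> discrete (f \o X).
Proof. by move=> mX A; exact: (mX (f @^-1` A)). Qed.

Lemma discrete_cst (V : Type) (v : V) : discrete (fun=> v).
Proof.
move=> A; have [Av|nAv] := pselect (A v).
  by rewrite (_ : _ @^-1` _ = setT)//; apply/seteqP; split.
by rewrite (_ : _ @^-1` _ = set0)//; apply/seteqP; split.
Qed.

Lemma discrete_points (V : countType) (X : T -> V) :
  (forall v, measurable (X @^-1` [set v])) -> discrete X.
Proof.
move=> mX A.
rewrite (_ : _ @^-1` _ =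
    \bigcup_v (if v \in A then X @^-1` [set v] else set0)); last first.
  apply/seteqP; split=> [t At|t [v _]].
    by exists (X t) => //; rewrite mem_set.
  by case: ifPn => // /set_mem Av /= ->.
apply: countable_bigcupT_measurable => [|v]; first exact: countableP.
by case: ifPn.
Qed.

Lemma discrete_pair (V W : countType) (X : T -> V) (Y : T -> W) :
  discrete X -> discrete Y -> discrete (fun t => (X t, Y t)).
Proof.
move=> mX mY; apply: discrete_points => -[v w].
rewrite (_ : _ @^-1` _ = X @^-1` [set v] `&` Y @^-1` [set w]).
  exact: measurableI.
by apply/seteqP; split=> t /= => [[-> ->]|[-> ->]].
Qed.

Lemma discrete_map (I : Type) (V : countType) (X : I -> T -> V) (J : seq I) :
  (forall a, discrete (X a)) -> discrete (fun t => map (X^~ t) J).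
Proof.
move=> mX; elim: J => [|a J IHJ] /=; first exact: discrete_cst.
exact: (discrete_comp (fun p : V * seq V => p.1 :: p.2)
  (discrete_pair (mX a) IHJ)).
Qed.

Lemma series_slices (V : countType) (X : T -> V) (B : set T) :
  discrete X -> measurable B ->
  P B = (\sum_(n <oo) P (B `&` [set t | pickle (X t) = n]))%E.
Proof.
move=> mX mB.
have mn n : measurable [set t | pickle (X t) = n].
  exact: (mX [set v | pickle v = n]).
rewrite -[in LHS](setIT B) (_ : setT = \bigcup_n [set t | pickle (X t) = n]).
  rewrite setI_bigcupr measure_bigcup => [|n _|].
  - by apply: eq_eseriesl => n; rewrite in_setT.
  - exact: measurableI.
  - by move=> i j _ _ [t [[_ /= <-] [_ /= <-]]].
by apply/seteqP; split=> // t _; exists (pickle (X t)).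
Qed.

(** Countable additivity in comparison form. Cutting along the values of X and
    of Y reduces an inequality between probabilities to one for each value,
    so that the arguments below never manipulate an infinite sum. The weights
    on the left are those of the averages [bin_avg]. *)
Lemma slice_le_sum (I : Type) (r : seq I) (c : I -> R) (c0 : R) (B : I -> set T)
    (D : set T) (V : countType) (X Y : T -> V) :
  discrete X -> discrete Y -> (forall i, measurable (B i)) -> measurable D ->
  (forall i, 0 <= c i) -> 0 <= c0 ->
  (forall v, \sum_(i <- r) c i * pr (B i `&` X @^-1` [set v])
             <= c0 * pr (D `&` Y @^-1` [set v])) ->
  \sum_(i <- r) c i * pr (B i) <= c0 * pr D.
Proof.
move=> mX mY mB mD c_ge0 c0_ge0 H.
rewrite -lee_fin EFinM -prE// -sumEFin.
rewrite (series_slices mY mD) -nneseriesZl//.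
under eq_bigr => i _.
  rewrite EFinM -prE// (series_slices mX (mB i)) -nneseriesZl//.
  over.
rewrite -nneseries_sum; last by move=> i j _; rewrite mule_ge0// lee_fin.
apply: lee_nneseries => [n _ _|n _].
  by rewrite sume_ge0// => i _; rewrite mule_ge0// lee_fin.
have [[w wn]|nv] := pselect (exists v : V, pickle v = n).
  have E (Z : T -> V) : [set t | pickle (Z t) = n] = Z @^-1` [set w].
    apply/seteqP; split=> t /=; last by move=> ->.
    by rewrite -wn => /(pcan_inj pickleK).
  rewrite !E (prE (measurableI _ _ mD (mY _))) -EFinM.
  under eq_bigr => i _.
    rewrite (prE (measurableI _ _ (mB i) (mX _))) -EFinM; over.
  by rewrite sumEFin lee_fin.
rewrite big1 ?mule_ge0 ?lee_fin// => i _.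
rewrite (_ : [set t | pickle (X t) = n] = set0) ?setI0 ?measure0 ?mule0//.
by apply/seteqP; split=> // t /= tn; case: nv; exists (X t).
Qed.

Lemma slice_le (c c0 : R) (B D : set T) (V : countType) (X Y : T -> V) :
  discrete X -> discrete Y -> measurable B -> measurable D ->
  0 <= c -> 0 <= c0 ->
  (forall v, c * pr (B `&` X @^-1` [set v])
             <= c0 * pr (D `&` Y @^-1` [set v])) ->
  c * pr B <= c0 * pr D.
Proof.
move=> mX mY mB mD c_ge0 c0_ge0 H.
have := @slice_le_sum unit [:: tt] (fun=> c) c0 (fun=> B) D V X Y.
by rewrite !big_seq1; apply => // v; rewrite big_seq1.
Qed.

Lemma slice_eq (c : R) (B D : set T) (V : countType) (X Y : T -> V) :
  discrete X -> discrete Y -> measurable B -> measurable D -> 0 <= c ->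
  (forall v, pr (B `&` X @^-1` [set v]) = c * pr (D `&` Y @^-1` [set v])) ->
  pr B = c * pr D.
Proof.
move=> mX mY mB mD c_ge0 H; apply/le_anti/andP; split.
  rewrite -(mul1r (pr B)).
  by apply: (slice_le mX mY) => // v; rewrite mul1r H.
rewrite -[leRHS]mul1r.
by apply: (slice_le mY mX) => // v; rewrite mul1r H.
Qed.

Section Family.
Context (I : eqType) (V : countType) (X : I -> T -> V).
Hypothesis mX : forall a, discrete (X a).

Definition hits (L : seq I) (A : I -> set V) : set T :=
  [set t | forall a, a \in L -> A a (X a t)].

(** Mutual independence of the X a, a in L, jointly with the event E, which
    stands for what has been observed before. Independence is stated list by
    list because a lemma about finitely many steps only knows those. *)
Definition indep_given (E : set T) (L : seq I) := forall A : I -> set V,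
  pr (E `&` hits L A) = pr E * \prod_(a <- L) pr (X a @^-1` A a).

Definition indep_on (L : seq I) := indep_given setT L.

Lemma measurable_hits L A : measurable (hits L A).
Proof.
elim: L => [|a L IHL].
  by rewrite (_ : hits _ _ = setT)//; apply/seteqP; split.
rewrite (_ : hits _ _ = X a @^-1` A a `&` hits L A).
  by apply: measurableI => //; exact: mX.
apply/seteqP; split=> t.
  by move=> H; split; [apply: H; rewrite mem_head|move=> b bL; apply: H;
    rewrite inE bL orbT].
by move=> [/= ? H] b; rewrite inE => /predU1P[->//|/H].
Qed.

Lemma measurable_event (B : set (seq V)) (J : seq I) :
  measurable [set t | B (map (X^~ t) J)].
Proof. exact: (discrete_map J mX B). Qed.

Lemma hits_cons a L A : hits (a :: L) A = X a @^-1` A a `&` hits L A.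
Proof.
apply/seteqP; split=> t.
  by move=> H; split; [apply: H; rewrite mem_head|move=> b bL; apply: H;
    rewrite inE bL orbT].
by move=> [/= ? H] b; rewrite inE => /predU1P[->//|/H].
Qed.

Lemma hits_nil A : hits [::] A = setT.
Proof. by apply/seteqP; split. Qed.

Lemma hits_seq1 a A : hits [:: a] A = X a @^-1` A a.
Proof. by rewrite hits_cons hits_nil setIT. Qed.

Lemma hits_sub_if E J L (A : I -> set V) : {subset J <= L} ->
  E `&` hits J A = E `&` hits L (fun a => if a \in J then A a else setT).
Proof.
move=> JL; congr (_ `&` _); apply/seteqP; split=> t H a aL.
  by case: ifPn => // /H.
by have := H a (JL _ aL); rewrite aL.
Qed.

(** The members of L outside J are given the full event, of probability 1. *)
Lemma indep_given_sub E J L : uniq J -> uniq L -> {subset J <= L} ->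
  indep_given E L -> indep_given E J.
Proof.
move=> uJ uL JL EL A; rewrite (hits_sub_if _ _ JL) EL; congr (_ * _).
rewrite (bigID (mem J))/= [X in _ * X]big1 ?mulr1; last first.
  by move=> a /negPf ->; rewrite preimage_setT prT.
rewrite -big_filter (eq_big_seq (fun a => pr (X a @^-1` A a))); last first.
  by move=> a; rewrite mem_filter => /andP[-> _].
apply: perm_big; apply: uniq_perm => //; first exact: filter_uniq.
by move=> a; rewrite mem_filter /=; case: (boolP (a \in J)) => // /JL.
Qed.

(** Fixing the value of the first variable moves it into the past. *)
Lemma indep_given_slice E a J v : uniq (a :: J) -> indep_given E (a :: J) ->
  pr (E `&` X a @^-1` [set v]) = pr E * pr (X a @^-1` [set v]) /\
  indep_given (E `&` X a @^-1` [set v]) J.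
Proof.
move=> /= /andP[aJ _] iE.
have neq b : b \in J -> (b == a) = false.
  by move=> bJ; apply/negP => /eqP ba; move: aJ; rewrite -ba bJ.
have slice A : pr (E `&` X a @^-1` [set v] `&` hits J A) =
    pr E * (pr (X a @^-1` [set v]) * \prod_(b <- J) pr (X b @^-1` A b)).
  have := iE (fun b => if b == a then [set v] else A b).
  rewrite hits_cons big_cons eqxx setIA => H.
  transitivity (pr (E `&` X a @^-1` [set v] `&`
      hits J (fun b => if b == a then [set v] else A b))).
    by congr (pr (_ `&` _)); apply/seteqP; split=> t Ht b bJ; have := Ht b bJ;
      rewrite neq.
  by rewrite H; congr (_ * (_ * _)); apply: eq_big_seq => b bJ; rewrite neq.
have slice0 : pr (E `&` X a @^-1` [set v]) = pr E * pr (X a @^-1` [set v]).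
  have := slice (fun=> setT); rewrite big1 ?mulr1 => [<-|b _].
    by congr pr; apply/seteqP; split=> t; [split|case].
  by rewrite preimage_setT prT.
by split=> // A; rewrite slice slice0 mulrA.
Qed.

Lemma indep_on_cons a J : uniq (a :: J) -> indep_on (a :: J) -> indep_on J.
Proof.
move=> uJ; apply: indep_given_sub => //; first by case/andP: uJ.
by move=> b bJ; rewrite inE bJ orbT.
Qed.

(** Independence for product events extends to all events in the variables of
    J. Cutting along the value of the first variable makes it part of the
    conditioning event, so the induction has to run over all E at once. *)
Lemma indep_given_event E J : uniq J -> measurable E -> indep_on J ->
  indep_given E J -> forall B : set (seq V),
  pr (E `&` [set t | B (map (X^~ t) J)]) =
  pr E * pr [set t | B (map (X^~ t) J)].
Proof.
elim: J E => [|a J IHJ] E uJ mE iJ iE B.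
  have [B0|nB0] := pselect (B [::]).
    rewrite (_ : [set t | _] = setT) ?setIT ?prT ?mulr1//.
    by apply/seteqP; split.
  rewrite (_ : [set t | _] = set0) ?setI0 ?pr0 ?mulr0//.
  by apply/seteqP; split.
have mB := measurable_event B (a :: J).
apply: (@slice_eq _ _ _ _ (X a) (X a)) => //; try exact: pr_ge0.
  exact: measurableI.
move=> v; pose B' : set (seq V) := fun s => B (v :: s).
have step E' : measurable E' -> indep_given E' (a :: J) ->
    pr (E' `&` [set t | B (map (X^~ t) (a :: J))] `&` X a @^-1` [set v]) =
    pr E' * pr (X a @^-1` [set v]) * pr [set t | B' (map (X^~ t) J)].
  move=> mE' iE'; have [E1 iE1] := indep_given_slice v uJ iE'.
  rewrite (_ : _ `&` _ `&` _ =
      E' `&` X a @^-1` [set v] `&` [set t | B' (map (X^~ t) J)]).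
    rewrite IHJ ?E1//; first by case/andP: uJ.
      by apply: measurableI => //; exact: mX.
    exact: indep_on_cons iJ.
  apply/seteqP; split=> t /=; last by move=> [[Et ->] H].
  by move=> [[Et H] Xv]; move: H; rewrite Xv => H.
rewrite step// -[X in pr E * pr (X `&` _)]setTI step// prT mul1r.
by rewrite mulrA.
Qed.

End Family.

(** The two families are sliced at the same value of their first members, and
    independence turns each slice into a product that depends on the marginal
    laws only. *)
Lemma same_law (I J : eqType) (V : countType) (X : I -> T -> V)
    (Y : J -> T -> V) (r : seq (I * J)) :
  (forall a, discrete (X a)) -> (forall a, discrete (Y a)) ->
  uniq (unzip1 r) -> uniq (unzip2 r) ->
  indep_on X (unzip1 r) -> indep_on Y (unzip2 r) ->
  (forall a b, (a, b) \in r -> forall v,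
     pr (X a @^-1` [set v]) = pr (Y b @^-1` [set v])) ->
  forall B : set (seq V),
  pr [set t | B (map (X^~ t) (unzip1 r))] =
  pr [set t | B (map (Y^~ t) (unzip2 r))].
Proof.
move=> mX mY; elim: r => [//|[a b] r IHr] uX uY iX iY XY B.
have /andP[_ ur1] := uX; have /andP[_ ur2] := uY.
have iX' := indep_on_cons uX iX; have iY' := indep_on_cons uY iY.
rewrite -[RHS]mul1r.
apply: (@slice_eq _ _ _ _ (X a) (Y b)) => //.
- exact: (measurable_event mX B (a :: _)).
- exact: (measurable_event mY B (b :: _)).
move=> v; rewrite mul1r.
pose B' : set (seq V) := fun s => B (v :: s).
have cut (K : eqType) (Z : K -> T -> V) c s :
    (forall a, discrete (Z a)) -> uniq (c :: s) -> indep_on Z (c :: s) ->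
  pr ([set t | B (Z c t :: map (Z^~ t) s)] `&` Z c @^-1` [set v]) =
  pr (Z c @^-1` [set v]) * pr [set t | B' (map (Z^~ t) s)].
  move=> mZ us iZ; have [_] := indep_given_slice v us iZ.
  rewrite setTI => iZs; have /andP[_ us'] := us.
  rewrite -(indep_given_event mZ us' (mZ c [set v]) (indep_on_cons us iZ) iZs).
  congr pr; apply/seteqP; split=> t /=; last by move=> [-> H].
  by move=> [+ Zv]; rewrite Zv => H.
rewrite !cut// IHr//; first by rewrite (XY a b) ?mem_head.
by move=> a' b' abr; apply: XY; rewrite inE abr orbT.
Qed.

End Independence.

(** * Binomial weights *)

Lemma central_bin_rec n :
  (n.+1 * 'C(n.+1.*2, n.+1) = 2 * (n.*2.+1 * 'C(n.*2, n)))%N.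
Proof.
have h1 := mul_bin_diag n.+1.*2 n; have h2 := mul_bin_down n.*2.+1 n.
rewrite doubleS /= in h1 *; rewrite /= (_ : (n.*2.+1 - n)%N = n.+1) in h2;
  last by lia.
apply/eqP; rewrite -(eqn_pmul2l (ltn0Sn n)); apply/eqP.
rewrite mulnCA h2 -h1.
by rewrite -mul2n; lia.
Qed.

(** The quotient of two consecutive values of C(2n, n)^2 (2n + 1) / 16^n is
    (2n + 1)(2n + 3) / (2n + 2)^2 < 1. *)
Lemma central_bin_upper n : ('C(n.*2, n) ^ 2 * n.*2.+1 <= 16 ^ n)%N.
Proof.
elim: n => [//|n IHn].
rewrite -(leq_pmul2l (_ : 0 < n.+1 ^ 2)%N) ?expn_gt0//.
rewrite mulnA -expnMn central_bin_rec expnMn expnMn [(16 ^ n.+1)%N]expnS.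
have : ((n.*2.+1 * n.+1.*2.+1) * ('C(n.*2, n) ^ 2 * n.*2.+1) <=
  (n.+1 ^ 2 * 4) * 16 ^ n)%N.
  by apply: leq_mul => //; rewrite -!mul2n; nia.
move: ('C(_, _)) (16 ^ n)%N => c e h.
rewrite (_ : (_ * _ * _)%N =
    (4 * (n.*2.+1 * n.+1.*2.+1 * (c ^ 2 * n.*2.+1)))%N); last by ring.
rewrite (_ : (n.+1 ^ 2 * (16 * e))%N = (4 * (n.+1 ^ 2 * 4 * e))%N); last by ring.
by rewrite leq_pmul2l.
Qed.

(** The quotient of two consecutive values of C(2n, n)^2 n / 16^n is
    (2n + 1)^2 / (4n(n + 1)) > 1. *)
Lemma central_bin_lower n : (16 ^ n.+1 <= 'C(n.+1.*2, n.+1) ^ 2 * (4 * n.+1))%N.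
Proof.
elim: n => [//|n IHn].
rewrite -(leq_pmul2l (_ : 0 < n.+2 ^ 2)%N) ?expn_gt0//.
rewrite mulnA -expnMn central_bin_rec expnMn expnMn [(16 ^ n.+2)%N]expnS.
have : ((n.+2 * (4 * n.+1)) * (4 * 16 ^ n.+1) <=
  (n.+1.*2.+1 ^ 2) * (4 * ('C(n.+1.*2, n.+1) ^ 2 * (4 * n.+1))))%N.
  by apply: leq_mul; [rewrite -!mul2n; nia|rewrite leq_mul2l].
move: ('C(_, _)) (16 ^ n.+1)%N => c e h.
rewrite -(@leq_pmul2l n.+1)//.
rewrite (_ : (n.+1 * (n.+2 ^ 2 * (16 * e)))%N =
    (n.+2 * (n.+2 * (4 * n.+1) * (4 * e)))%N); last by ring.
rewrite (_ : (n.+1 * (2 ^ 2 * (n.+1.*2.+1 ^ 2 * c ^ 2) * (4 * n.+2)))%N =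
    (n.+2 * (n.+1.*2.+1 ^ 2 * (4 * (c ^ 2 * (4 * n.+1)))))%N); last by ring.
by rewrite leq_pmul2l.
Qed.

Lemma bin_le_central n i : ('C(n.*2, i) <= 'C(n.*2, n))%N.
Proof.
have low k : (k <= n -> 'C(n.*2, n - k) <= 'C(n.*2, n))%N.
  elim: k => [|k IHk] kn; first by rewrite subn0.
  apply: leq_trans (IHk (ltnW kn)).
  rewrite -(@leq_pmul2l (n - k)); last by lia.
  have -> : (n - k = (n - k.+1).+1)%N by lia.
  by rewrite mul_bin_left leq_mul2r; apply/orP; right; lia.
have [ni|ni] := leqP i n.
  by have := low (n - i)%N; rewrite subKn// leq_subr; apply.
have [i2|i2] := leqP i n.*2; last by rewrite bin_small.
have := low (i - n)%N; rewrite -(bin_sub i2).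
by rewrite (_ : (n - (i - n) = n.*2 - i)%N); [apply; lia|lia].
Qed.

(** An entry of an even row is at most the central one; an entry of an odd row
    is at most twice the central entry of the row above, which is where the
    extra factor 4 is spent. *)
Lemma bin_concentration j i : ('C(j, i) ^ 2 * j.+1 <= 4 ^ j.+1)%N.
Proof.
have ev n k : ('C(n.*2, k) ^ 2 * n.*2.+1 <= 16 ^ n)%N.
  apply: leq_trans (central_bin_upper n).
  by rewrite leq_mul2r leq_exp2r// bin_le_central orbT.
have e16 n : (16 ^ n = 4 ^ n.*2)%N by rewrite -mul2n expnM.
rewrite -(odd_double_half j); case: (odd j); rewrite ?add0n ?add1n; last first.
  by apply: leq_trans (ev _ _) _; rewrite e16 leq_exp2l.
move: (_./2) => n.
rewrite !expnS -e16.
have : ('C(n.*2.+1, i) <= 2 * 'C(n.*2, n))%N.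
  case: i => [|i]; last by rewrite binS; have := bin_le_central n i;
    have := bin_le_central n i.+1; lia.
  rewrite bin0; have : (0 < 'C(n.*2, n))%N by rewrite bin_gt0; lia.
  by lia.
have := central_bin_upper n.
move: ('C(n.*2.+1, i)) ('C(n.*2, n)) (16 ^ n)%N => c' c e h h'.
have h2 : (c' ^ 2 <= 4 * c ^ 2)%N by rewrite -(expnMn 2 c 2) leq_exp2r.
apply: (@leq_trans (4 * c ^ 2 * (2 * n.*2.+1))); first by apply: leq_mul; lia.
rewrite (_ : (_ * _)%N = (8 * (c ^ 2 * n.*2.+1))%N); last by ring.
by rewrite [(4 * (4 * e))%N]mulnA leq_mul.
Qed.

Section Concentration.
Variable R : realType.
Implicit Types (a b z : int) (g : int -> R).

(** Expectation of g (z - W) when W is a sum of j independent fair choices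
    between a and b. *)
Definition bin_avg a b j g z : R :=
  \sum_(i < j.+1) 'C(j, i)%:R / 2 ^+ j * g (z - a *+ j - (b - a) *+ i).

Lemma bin_avg0 a b g z : bin_avg a b 0 g z = g z.
Proof.
by rewrite /bin_avg big_ord1 bin0 expr0 divr1 mul1r !mulr0n !subr0.
Qed.

Lemma bin_avgS a b j g z :
  bin_avg a b j.+1 g z = (bin_avg a b j g (z - a) + bin_avg a b j g (z - b)) / 2.
Proof.
pose G i := g (z - a *+ j.+1 - (b - a) *+ i).
have Ea : bin_avg a b j g (z - a) =
    \sum_(i < j.+2) 'C(j, i)%:R / 2 ^+ j * G i.
  rewrite big_ord_recr /= bin_small// !mul0r addr0.
  by apply: eq_bigr => i _; rewrite /G; congr (_ * g _); rewrite mulrS; ring.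
have Eb : bin_avg a b j g (z - b) =
    \sum_(i < j.+1) 'C(j, i)%:R / 2 ^+ j * G i.+1.
  apply: eq_bigr => i _; rewrite /G; congr (_ * g _).
  by rewrite ![in RHS]mulrS; ring.
rewrite Ea Eb big_ord_recl /= bin0 -addrA -big_split /= /bin_avg.
rewrite big_ord_recl /= bin0 mulrDl mulr_suml; congr (_ + _).
  by rewrite exprS invfM /G; ring.
apply: eq_bigr => i _; rewrite /bump /= add1n binS natrD exprS invfM /G; ring.
Qed.

Lemma bin_avg_le a b j g z c :
  (forall y, g y <= c) -> bin_avg a b j g z <= c.
Proof.
move=> gc; elim: j z => [|j IHj] z; first by rewrite bin_avg0.
rewrite bin_avgS; have := IHj (z - a); have := IHj (z - b); lra.
Qed.

Lemma bin_avg_delta_ge0 a b j z : 0 <= bin_avg a b j (fun y => (y == 0)%:R) z.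
Proof. by apply: sumr_ge0 => i _; rewrite mulr_ge0 ?divr_ge0 ?exprn_ge0. Qed.

(** As a <> b, at most one number of choices of b leads from 0 to z, so that the
    average is a single binomial weight. *)
Lemma bin_avg_delta_le a b j z : a != b ->
  bin_avg a b j (fun y => (y == 0)%:R) z <= 2 / Num.sqrt j.+1%:R.
Proof.
move=> ab.
have c_le i : 'C(j, i)%:R / 2 ^+ j <= 2 / Num.sqrt (j.+1%:R : R).
  have s0 : 0 < Num.sqrt (j.+1%:R : R) by rewrite sqrtr_gt0.
  rewrite ler_pdivlMr// mulrAC ler_pdivrMr ?exprn_gt0// -exprS.
  rewrite -ler_sqr ?nnegrE ?mulr_ge0 ?exprn_ge0//.
  rewrite exprMn sqr_sqrtr// -natrX -natrM -exprM mulnC exprM -!natrX ler_nat.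
  by rewrite mulnC -expnM [(j.+1 * 2)%N]mulnC expnM; exact: bin_concentration.
have [i0 zi0|no] := pickP (fun i : 'I_j.+1 => z - a *+ j - (b - a) *+ i == 0).
  rewrite /bin_avg (bigD1 i0)//= big1 ?addr0 => [|i ii0].
    apply: le_trans (c_le i0).
    by rewrite ler_piMr ?divr_ge0 ?exprn_ge0// (ler_nat _ _ 1) leq_b1.
  case: eqP => [zi|_]; last by rewrite mulr0.
  have ba : b - a != 0 by rewrite subr_eq0 eq_sym.
  case/eqP: ii0; apply/val_inj/(mulrIn ba).
  move/eqP: zi zi0; rewrite !subr_eq0 => /eqP zi /eqP zi0.
  by rewrite -[LHS]zi -[RHS]zi0.
rewrite /bin_avg big1 ?divr_ge0 ?sqrtr_ge0// => i _.
by rewrite no mulr0.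
Qed.

(** In [concentration] a step of the walk has, with probability q, the effect of
    one more fair choice; this inequality says that its effect on the bound
    1 / sqrt s is at least that of adding q / 3 to s. *)
Lemma inv_sqrt_step (s q : R) : 1 <= s -> 0 <= q <= 1 ->
  q / Num.sqrt (s + 1) + (1 - q) / Num.sqrt s <= (Num.sqrt (s + q / 3))^-1.
Proof.
move=> s1 /andP[q0 q1].
set x := Num.sqrt s; set y := Num.sqrt (s + 1); set w := Num.sqrt (s + q / 3).
have s0 : 0 <= s by lra.
have x1 : 1 <= x by rewrite -sqrtr1 ler_sqrt.
have xx : x ^+ 2 = s by rewrite sqr_sqrtr.
have yy : y ^+ 2 = s + 1 by rewrite sqr_sqrtr//; lra.
have ww : w ^+ 2 = s + q / 3 by rewrite sqr_sqrtr//; lra.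
have xw : x <= w by rewrite ler_sqrt; lra.
have xy : x <= y by rewrite ler_sqrt; lra.
have y2 : y <= 2 * x.
  have [y0 x0] : 0 <= y /\ 0 <= 2 * x by split; lra.
  by rewrite -ler_sqr ?nnegrE// exprMn yy xx; lra.
(* 1/x - 1/w <= q/(6 x^3)  and  1/x - 1/y >= 1/(6 x^3) *)
have w0 : 0 < w by lra.
have y0 : 0 < y by lra.
have x0 : 0 < x by lra.
have hw : x^-1 - w^-1 <= q / (6 * x ^+ 3).
  rewrite (_ : x^-1 - w^-1 = (w ^+ 2 - x ^+ 2) / (x * w * (x + w))); last first.
    by field; rewrite !gt_eqF//; lra.
  rewrite ww xx addrAC subrr add0r -[leLHS]mulrA ler_wpM2l// -invfM lef_pV2 ?posrE.
  - have : x * x * (x + x) <= x * w * (x + w).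
      by apply: ler_pM; rewrite ?mulr_ge0 ?ler_wpM2l ?lerD ?addr_ge0//; lra.
    by rewrite (_ : x ^+ 3 = x * x * x); [lra|ring].
  - by rewrite ?mulr_gt0 ?exprn_gt0 ?addr_gt0.
  - by rewrite ?mulr_gt0 ?exprn_gt0 ?addr_gt0.
have hy : (6 * x ^+ 3)^-1 <= x^-1 - y^-1.
  rewrite (_ : x^-1 - y^-1 = (y ^+ 2 - x ^+ 2) / (x * y * (x + y))); last first.
    by field; rewrite !gt_eqF//; lra.
  rewrite yy xx addrAC subrr add0r mul1r lef_pV2 ?posrE.
  - have : x * y * (x + y) <= x * (2 * x) * (x + 2 * x).
      by apply: ler_pM; rewrite ?mulr_ge0 ?ler_wpM2l ?lerD ?addr_ge0//; lra.
    by rewrite (_ : x ^+ 3 = x * x * x); [lra|ring].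
  - by rewrite ?mulr_gt0 ?exprn_gt0 ?addr_gt0.
  - by rewrite ?mulr_gt0 ?exprn_gt0 ?addr_gt0.
have := ler_wpM2l q0 hy; lra.
Qed.
End Concentration.

(** * Blocks, coordinates and concentration of sums *)

Section Blocks.
Context (R : realType) (d : measure_display) (T : measurableType d).
Variable P : probability T R.
Local Notation pr := (pr P).

Lemma indep_comp (I : eqType) (V W : countType) (X : I -> T -> V)
    (f : I -> V -> W) (J : seq I) :
  indep_on P X J -> indep_on P (fun a => f a \o X a) J.
Proof. by move=> iX A; exact: (iX (fun a => f a @^-1` A a)). Qed.

Section OneFamily.
Context (I : eqType) (V : countType) (X : I -> T -> V).
Hypothesis mX : forall a, discrete (X a).
Local Notation event B J := [set t | B (map (X^~ t) J)].

Lemma hits_cat L1 L2 A : hits X (L1 ++ L2) A = hits X L1 A `&` hits X L2 A.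
Proof.
elim: L1 => [|a L IHL]; last by rewrite /= !hits_cons IHL setIA.
by rewrite (_ : hits X [::] A = setT) ?setTI//; apply/seteqP; split.
Qed.

(** Conditioning on an event of the first block leaves the second block
    independent: blocks can be peeled off one at a time. *)
Lemma indep_given_cat E L1 L2 (B : set (seq V)) : uniq (L1 ++ L2) ->
  measurable E -> indep_on P X (L1 ++ L2) -> indep_given P X E (L1 ++ L2) ->
  indep_given P X (E `&` event B L1) L2 /\
  pr (E `&` event B L1) = pr E * pr (event B L1).
Proof.
move=> uL mE iL iE; have := uL; rewrite cat_uniq => /and3P[u1 dis u2].
have sub F : indep_given P X F (L1 ++ L2) ->
    indep_given P X F L1 /\ indep_given P X F L2.
  by move=> iF; split; apply: indep_given_sub iF => // a aL;
    rewrite mem_cat aL ?orbT.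
have [i1 i2] := sub _ iL; have [e1 e2] := sub _ iE.
have EB : pr (E `&` event B L1) = pr E * pr (event B L1).
  exact: indep_given_event.
split=> // A; rewrite EB setIAC indep_given_event//.
- by rewrite e2 mulrAC.
- by apply: measurableI => //; exact: measurable_hits.
move=> A'; rewrite e2.
have := iE (fun a => if a \in L1 then A' a else A a).
have E1 a : a \in L2 -> (a \in L1) = false.
  by move=> a2; apply: contraNF dis => a1; apply/hasP; exists a.
rewrite hits_cat big_cat /= => H.
transitivity (pr (E `&` (hits X L1 (fun a => if a \in L1 then A' a else A a) `&`
      hits X L2 (fun a => if a \in L1 then A' a else A a)))).
  congr pr; rewrite -setIA [X in _ `&` X]setIC; congr (_ `&` (_ `&` _)).
    by apply/seteqP; split=> t Ht a aL; have := Ht _ aL; rewrite aL.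
  by apply/seteqP; split=> t Ht a aL; have := Ht _ aL; rewrite E1.
rewrite H mulrA mulrAC; congr (_ * _ * _); apply: eq_big_seq => a aL.
  by rewrite E1.
by rewrite aL.
Qed.

Lemma indep_two_blocks L1 L2 (B1 B2 : set (seq V)) : uniq (L1 ++ L2) ->
  indep_on P X (L1 ++ L2) ->
  pr (event B1 L1 `&` event B2 L2) = pr (event B1 L1) * pr (event B2 L2).
Proof.
move=> uL iL.
have [] := @indep_given_cat setT L1 L2 B1 uL measurableT iL iL.
rewrite setTI => i1 _; rewrite indep_given_event//.
- by have := uL; rewrite cat_uniq => /and3P[].
- exact: measurable_event.
- apply: indep_given_sub iL => //.
    by have := uL; rewrite cat_uniq => /and3P[].
  by move=> a aL; rewrite mem_cat aL orbT.
Qed.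

Lemma indep_blocks (K : eqType) (C : seq K) (L : K -> seq I)
    (B : K -> set (seq V)) :
  uniq (flatten (map L C)) -> indep_on P X (flatten (map L C)) ->
  pr [set t | forall i, i \in C -> B i (map (X^~ t) (L i))] =
  \prod_(i <- C) pr (event (B i) (L i)).
Proof.
move=> uC iC.
suff H E : measurable E -> indep_given P X E (flatten (map L C)) ->
    pr (E `&` [set t | forall i, i \in C -> B i (map (X^~ t) (L i))]) =
    pr E * \prod_(i <- C) pr (event (B i) (L i)).
  by have := H setT measurableT iC; rewrite setTI prT mul1r.
elim: C E uC iC => [|i C IHC] E /= uC iC mE iE.
  rewrite big_nil (_ : [set t | _] = setT) ?setIT ?mulr1//.
  by apply/seteqP; split.
have [iE' EB] := indep_given_cat (B i) uC mE iC iE.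
rewrite (_ : E `&` _ = E `&` event (B i) (L i) `&`
  [set t | forall i, i \in C -> B i (map (X^~ t) (L i))]); last first.
  rewrite -setIA; congr (_ `&` _); apply/seteqP; split=> t /=.
    by move=> H; split; [exact/H/mem_head|move=> j jC; apply: H;
      rewrite inE jC orbT].
  by move=> [Bi H] j; rewrite inE => /predU1P[->|/H].
have := uC; rewrite cat_uniq => /and3P[_ _ uC'].
rewrite IHC//.
- by rewrite EB big_cons mulrA.
- apply: indep_given_sub iC => // a aL; by rewrite mem_cat aL orbT.
- by apply: measurableI => //; exact: measurable_event.
Qed.

End OneFamily.

Section Coordinates.
Context (K : eqType) (m : nat) (Y : K -> T -> 'rV[int]_m).
Hypothesis mY : forall k, discrete (Y k).
Variables (J : seq K) (C : seq 'I_m).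
Hypotheses (uJ : uniq J) (uC : uniq C) (iY : indep_on P Y J).
Hypothesis coordY : forall k (A : 'I_m -> set int), k \in J ->
  pr [set t | forall i, i \in C -> A i (Y k t 0 i)] =
  \prod_(i <- C) pr [set t | A i (Y k t 0 i)].

Let X (a : K * 'I_m) (t : T) : int := Y a.1 t 0 a.2.

Lemma indep_entries : indep_on P X [seq (k, i) | k <- J, i <- C].
Proof.
move=> A; rewrite prT mul1r setTI.
rewrite (_ : hits X _ A = setT `&` hits Y J
  (fun k => [set v | forall i, i \in C -> A (k, i) (v 0 i)])).
  rewrite iY prT mul1r big_allpairs_dep; apply: eq_big_seq => k kJ.
  exact: (coordY (fun i => A (k, i)) kJ).
rewrite setTI; apply/seteqP; split=> t H.
  by move=> k kJ i iC; apply: H; apply: allpairs_f.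
by move=> [k i] /allpairsP[[k' i'] [/= kJ iC [-> ->]]]; exact: H.
Qed.

(** The entries of the vectors Y k are independent as a doubly indexed family;
    grouped by coordinate instead of by k they form independent blocks, one
    for each coordinate of the sum. *)
Lemma coordinate_sums (z : 'I_m -> int) :
  pr [set t | forall i, i \in C -> \sum_(k <- J) Y k t 0 i = z i] =
  \prod_(i <- C) pr [set t | \sum_(k <- J) Y k t 0 i = z i].
Proof.
have mX a : discrete (X a).
  exact: (discrete_comp (fun v : 'rV[int]_m => v 0 a.2) (mY a.1)).
have uL : uniq (flatten [seq [seq (k, i) | k <- J] | i <- C]).
  apply: (@allpairs_uniq _ _ _ (fun i k => (k, i)) C J) => //.
  by move=> [? ?] [? ?] _ _ [-> ->].
have iL : indep_on P X (flatten [seq [seq (k, i) | k <- J] | i <- C]).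
  apply: indep_given_sub indep_entries => //.
    by apply: allpairs_uniq => // -[? ?] [? ?] _ _ [-> ->].
  move=> a /allpairsP[[i k] [/= iC kJ ->]]; exact: allpairs_f.
have := @indep_blocks _ _ X mX _ C (fun i => [seq (k, i) | k <- J])
  (fun i => [set s | \sum_(x <- s) x = z i]) uL iL.
under eq_fun do under eq_forall do rewrite -map_comp /= big_map.
move=> ->; apply: eq_bigr => i _; congr pr; apply/seteqP.
by split=> t; rewrite /= -map_comp big_map.
Qed.

End Coordinates.

Lemma sum_event (I : Type) (V : zmodType) (X : I -> T -> V) (J : seq I) (z : V) :
  [set t | [set u | \sum_(w <- u) w = z] (map (X^~ t) J)] =
  [set t | \sum_(k <- J) X k t = z].
Proof. by apply/funext => t; rewrite /mkset big_map. Qed.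

Section Sums.
Context (I : eqType) (X : I -> T -> int).
Hypothesis mX : forall k, discrete (X k).

Lemma measurable_sum J z : measurable [set t | \sum_(k <- J) X k t = z].
Proof. by rewrite -sum_event; exact: measurable_event. Qed.

Lemma pr_sum_nil z : pr [set t | \sum_(k <- [::]) X k t = z] = (z == 0)%:R.
Proof.
case: eqP => [->|z0].
  rewrite (_ : [set t | _] = setT) ?prT//.
  by apply/seteqP; split=> // t _ /=; rewrite big_nil.
rewrite (_ : [set t | _] = set0) ?pr0//; apply/seteqP; split=> // t /=.
by rewrite big_nil => /esym.
Qed.

Lemma pr_sum_cons k J v z : uniq (k :: J) -> indep_on P X (k :: J) ->
  pr ([set t | \sum_(l <- k :: J) X l t = z] `&` X k @^-1` [set v]) =
  pr (X k @^-1` [set v]) * pr [set t | \sum_(l <- J) X l t = z - v].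
Proof.
move=> uJ iJ; have := @indep_two_blocks _ _ X mX [:: k] J [set [:: v]]
  [set u | \sum_(w <- u) w = z - v] uJ iJ.
rewrite (_ : [set t | [set [:: v]] _] = X k @^-1` [set v]); last first.
  by apply/seteqP; split=> t /= => [[]|->].
rewrite sum_event => <-; congr pr; apply/seteqP; split=> t /=.
  by rewrite big_cons => -[<- ->]; rewrite [v + _]addrC addrK.
by rewrite big_cons => -[-> ->]; rewrite addrC subrK.
Qed.

End Sums.

(** A Littlewood-Offord bound. Each X k contains a fair choice between a and b
    with probability 2 h k, and a sum of j fair choices puts mass at most
    2 / sqrt (j + 1) on a point. The induction on J bounds not only the mass
    of the sum of the X k at a point but also its averages over j further fair
    choices, for all j: removing one X k either turns into one more fair choice
    or averages the bound that is already known. *)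
Lemma concentration (I : eqType) (X : I -> T -> int) (h : I -> R) (a b : int)
    (J : seq I) (z : int) :
  (forall k, discrete (X k)) -> uniq J -> indep_on P X J -> a != b ->
  (forall k, k \in J -> 0 <= h k) ->
  (forall k, k \in J -> h k <= pr (X k @^-1` [set a])) ->
  (forall k, k \in J -> h k <= pr (X k @^-1` [set b])) ->
  pr [set t | \sum_(k <- J) X k t = z] <=
    2 / Num.sqrt (1 + 2 / 3 * \sum_(k <- J) h k).
Proof.
move=> mX uJ iJ ab h0 ha hb.
suff H j y : bin_avg a b j (fun y => pr [set t | \sum_(k <- J) X k t = y]) y <=
    2 / Num.sqrt (j.+1%:R + 2 / 3 * \sum_(k <- J) h k).
  by have := H 0%N z; rewrite bin_avg0.
elim: J uJ iJ h0 ha hb j y => [|k J IHJ] uJ iJ h0 ha hb j y.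
  rewrite big_nil mulr0 addr0.
  rewrite (_ : (fun _ => _) = (fun y => (y == 0)%:R)).
    exact: bin_avg_delta_le.
  by apply/funext => x; exact: pr_sum_nil.
have /andP[kJ uJ'] := uJ.
have sub l : l \in J -> l \in k :: J by rewrite inE orbC => ->.
have iJ' : indep_on P X J by apply: indep_given_sub iJ.
have {IHJ} := IHJ uJ' iJ' (fun l H => h0 l (sub l H))
  (fun l H => ha l (sub l H)) (fun l H => hb l (sub l H)).
set g := fun y => pr [set t | \sum_(k <- J) X k t = y].
set s := \sum_(k <- J) h k => IHJ.
have s0 : 0 <= s by rewrite /s big_seq; apply: sumr_ge0 => l /sub; exact: h0.
rewrite big_cons -/s.
pose ev y := [set t | \sum_(k <- k :: J) X k t = y].
have mev x : measurable (ev x) by exact: measurable_sum.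
have cut v x : pr (ev x `&` X k @^-1` [set v]) =
    pr (X k @^-1` [set v]) * g (x - v) by exact: pr_sum_cons.
pose N := ~` (X k @^-1` [set a] `|` X k @^-1` [set b]).
have mab : measurable (X k @^-1` [set a] `|` X k @^-1` [set b]).
  by apply: measurableU; exact: mX.
have mN : measurable N by exact: measurableC.
have dis : X k @^-1` [set a] `&` X k @^-1` [set b] = set0.
  by apply/seteqP; split=> // t [/= -> /eqP]; rewrite (negPf ab).
have split3 x : pr (ev x) = pr (X k @^-1` [set a]) * g (x - a) +
    pr (X k @^-1` [set b]) * g (x - b) + pr (ev x `&` N).
  rewrite -!cut -prU; last first.
  - by rewrite setIACA dis setI0.
  - by apply: measurableI => //; exact: mX.
  - by apply: measurableI => //; exact: mX.
  rewrite -setIUr -prU.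
  - by rewrite -setIUr setUv setIT.
  - exact: measurableI.
  - exact: measurableI.
  - by rewrite setIACA setICr setI0.
set pa := pr (X k @^-1` [set a]) in split3.
set pb := pr (X k @^-1` [set b]) in split3.
have EN : pr N = 1 - (pa + pb) by rewrite prC// prU//; exact: mX.
have hpa : h k <= pa by rewrite ha ?mem_head.
have hpb : h k <= pb by rewrite hb ?mem_head.
have hk0 : 0 <= h k by rewrite h0 ?mem_head.
have N0 : 0 <= pr N by exact: pr_ge0.
set q := 2 * h k.
set r := j.+1%:R + 2 / 3 * s.
have r1 : 1 <= r by rewrite /r -addn1 natrD; have : 0 <= j%:R :> R by []; lra.
pose beta := 2 / Num.sqrt r.
have beta0 : 0 <= beta by rewrite divr_ge0 ?sqrtr_ge0.
have G_le x : bin_avg a b j g x <= beta by exact: IHJ.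
have GS_le x : bin_avg a b j.+1 g x <= 2 / Num.sqrt (r + 1).
  by rewrite (_ : r + 1 = j.+2%:R + 2 / 3 * s)// /r -[j.+2]addn1 natrD; ring.
(* The part of X k outside {a, b} is an average of translates of g. *)
have key : bin_avg a b j (fun x => pr (ev x)) y <=
    pa * bin_avg a b j g (y - a) + pb * bin_avg a b j g (y - b) + beta * pr N.
  rewrite /bin_avg; under eq_bigr do rewrite split3 !mulrDr.
  rewrite !big_split /= !mulr_sumr; apply: lerD; first apply: lerD.
  - apply: ler_sum => i _; rewrite mulrCA ler_wpM2l// ?pr_ge0//.
    by rewrite le_eqVlt; apply/orP; left; apply/eqP; congr (_ * g _); ring.
  - apply: ler_sum => i _; rewrite mulrCA ler_wpM2l// ?pr_ge0//.
    by rewrite le_eqVlt; apply/orP; left; apply/eqP; congr (_ * g _); ring.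
  apply: (@slice_le_sum _ _ _ P _ _ _ _ _ _ _ (X k) (X k)) => //.
    by move=> i; exact: measurableI.
  move=> v.
  have [Nv|nNv] := pselect (v != a /\ v != b); last first.
    rewrite big1 ?mulr_ge0 ?pr_ge0// => i _.
    rewrite (_ : _ `&` _ `&` _ = set0) ?pr0 ?mulr0//.
    apply/seteqP; split=> // t [[_ Nt] /= Xv]; case: nNv.
    by split; apply/eqP => vE; apply: Nt; [left|right]; rewrite /= Xv.
  have Xv : N `&` X k @^-1` [set v] = X k @^-1` [set v].
    rewrite setIC; apply/setIidPl => t Xtv; case: Nv => /eqP va /eqP vb.
    by move=> [] /= Xt; [apply: va|apply: vb]; rewrite -Xtv -Xt.
  rewrite Xv; under eq_bigr do rewrite -setIA Xv cut mulrCA.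
  rewrite -mulr_sumr mulrC ler_wpM2r ?pr_ge0//.
  apply: le_trans (G_le (y - v)).
  rewrite le_eqVlt; apply/orP; left; apply/eqP; apply: eq_bigr => i _.
  by congr (_ * g _); ring.
have q01 : 0 <= q <= 1 by rewrite /q; apply/andP; split; lra.
have := inv_sqrt_step r1 q01.
rewrite (_ : j.+1%:R + _ = r + q / 3); last by rewrite /r /q; lra.
have := GS_le y; rewrite bin_avgS.
have := G_le (y - a); have := G_le (y - b); move: key.
set Ga := bin_avg _ _ _ g (y - a); set Gb := bin_avg _ _ _ g (y - b).
rewrite EN /beta.
set f0 := (Num.sqrt r)^-1; set f1 := (Num.sqrt (r + 1))^-1.
set f2 := (Num.sqrt _)^-1 => key Gb_le Ga_le G1 stp.
apply: le_trans key _.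
have ea : (pa - h k) * Ga <= (pa - h k) * (2 * f0) by rewrite ler_wpM2l ?subr_ge0.
have eb : (pb - h k) * Gb <= (pb - h k) * (2 * f0) by rewrite ler_wpM2l ?subr_ge0.
have eh : q * ((Ga + Gb) / 2) <= q * (2 * f1) by rewrite ler_wpM2l//; case/andP: q01.
by rewrite /q in eh stp *; lra.
Qed.

End Blocks.

(** * Law of the increments *)

Section StepLaw.
Context (R : realType) (m : nat) (F : probability (lattice m) R).
Hypothesis hF : step_distribution F.

Lemma prod_pr (d : measure_display) (T : measurableType d)
    (P : probability T R) (I : Type) (J : seq I) (B : I -> set T) :
  (forall i, measurable (B i)) ->
  (\prod_(i <- J) P (B i))%E = (\prod_(i <- J) pr P (B i))%:E.
Proof.
move=> mB; elim: J => [|i J IHJ]; first by rewrite !big_nil.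
by rewrite !big_cons IHJ EFinM (prE P (mB i)).
Qed.

Lemma measurable_int_image (A : set int) :
  measurable ([set z%:~R | z in A] : set R).
Proof.
rewrite -bigcup_imset1 bigcup_mkcond.
apply: countable_bigcupT_measurable => [|z]; first exact: countableP.
by case: ifP => // _; exact: measurable_set1.
Qed.

Lemma step_coords (C : seq 'I_m) (A : 'I_m -> set int) : uniq C ->
  pr F [set y : lattice m | forall i, i \in C -> A i (y 0 i)] =
  \prod_(i <- C) pr F [set y : lattice m | A i (y 0 i)].
Proof.
move=> uC; pose A' i : set R := [set z%:~R | z in A i].
have E i : Defs.coord R i @^-1` A' i = [set y : lattice m | A i (y 0 i)].
  apply/seteqP; split=> y /=; last by move=> Ay; exists (y 0 i).
  by move=> [z Az]; rewrite /Defs.coord => /intr_inj <-.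
have := step_indep hF uC (fun i => measurable_int_image (A i)).
rewrite (_ : \bigcap_(i in _) _ =
    [set y : lattice m | forall i, i \in C -> A i (y 0 i)]); last first.
  by apply: eq_bigcapr => i _; exact: E.
rewrite (eq_bigr (fun i => F [set y : lattice m | A i (y 0 i)])); last first.
  by move=> i _; congr (F _); exact: E.
rewrite prod_pr// => H.
by apply: EFin_inj; rewrite -H -prE.
Qed.

(** A coordinate that is almost surely equal to a has mean a, so a = 0; the law
    then lives on a coordinate hyperplane and is not truly dimensional. *)
Lemma coord_not_cst (i : 'I_m) (a : int) :
  0 < pr F [set y : lattice m | y 0 i != a].
Proof.
rewrite lt_neqAle pr_ge0 andbT eq_sym; apply/negP => /eqP Fa.
have aeF : F.-negligible [set y : lattice m | y 0 i != a].
  by exists [set y : lattice m | y 0 i != a]; split=> //; rewrite prE ?Fa.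
have a0 : a = 0.
  have := step_mean0 hF i.
  rewrite unlock (_ : (\int[F]_x (Defs.coord R i x)%:E)%E =
    (\int[F]_(x in setT) (a%:~R)%:E)%E).
    rewrite integral_cst//= probability_setT mule1 => /eqP.
    by rewrite (eqe (a%:~R : R) 0) intr_eq0 => /eqP.
  apply: ae_eq_integral => //.
  by apply: (negligibleS _ aeF) => y /= H; apply/negP => /eqP ya;
    apply: H => _; rewrite /Defs.coord ya.
pose f : 'Hom('rV[R]_m, 'M[R]_(1, 1)) := linfun (mulmxr (delta_mx i 0)).
have fE (v : 'rV[R]_m) : (v \in lker f) = (v 0 i == 0).
  rewrite memv_ker lfunE /= -colE.
  by apply/eqP/eqP => [/matrixP/(_ 0 0)|vi]; [rewrite !mxE|
    apply/matrixP => ? ?; rewrite !mxE !ord1].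
have := @step_truly _ _ _ hF (lker f).
rewrite (_ : [set z | _] = [set y : lattice m | y 0 i != a]); last first.
  by apply/funext => z; rewrite /= fE mxE intr_eq0 a0.
rewrite prE// Fa => /(_ erefl) kf.
have := fE (delta_mx 0 i); rewrite kf memvf mxE !eqxx /= => /esym.
by rewrite oner_eq0.
Qed.

Lemma pr_atom (V : countType) (X : lattice m -> V) (D : set (lattice m)) :
  0 < pr F D -> exists v, 0 < pr F (D `&` X @^-1` [set v]).
Proof.
move=> D0; apply: contrapT => H.
have Z v : pr F (D `&` X @^-1` [set v]) = 0.
  apply: contrapT => /eqP nz; apply: H; exists v => //.
  by rewrite lt_neqAle eq_sym nz pr_ge0.
have := @slice_eq _ _ _ F 0 D D V X X.
rewrite mul0r => /(_ _ _ _ _ _ _)  E; move: D0; rewrite E ?ltxx//.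
by move=> v; rewrite mul0r Z.
Qed.

(** These two values are the a and b to which [concentration] is applied. *)
Lemma coord_two_atoms (i : 'I_m) : exists a b : int, [/\ a != b,
  0 < pr F [set y : lattice m | y 0 i = a] &
  0 < pr F [set y : lattice m | y 0 i = b]].
Proof.
have T0 : 0 < pr F setT by rewrite prT.
have [a +] := @pr_atom _ (fun y : lattice m => y 0 i) setT T0.
rewrite setTI => a0.
have [b +] := @pr_atom _ (fun y : lattice m => y 0 i) _ (coord_not_cst i a).
have [->|ba] := eqVneq b a.
  rewrite (_ : _ `&` _ = set0) ?pr0 ?ltxx//; apply/seteqP; split=> // y [/= + ya].
  by rewrite ya eqxx.
move=> b0; exists a, b; split; [by rewrite eq_sym|exact: a0|].
apply: lt_le_trans b0 _; apply: le_pr => // y; by case.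
Qed.

End StepLaw.

Lemma first_coordsE m n (z : lattice m) (i : 'I_n) (j : 'I_m) :
  val i = val j -> first_coords n z 0 i = z 0 j.
Proof. by move=> ij; rewrite mxE ij valK. Qed.

Lemma first_coords_big m n (z : lattice m) (i : 'I_n) :
  (m <= i)%N -> first_coords n z 0 i = 0.
Proof. by move=> mi; rewrite mxE insubF// ltnNge mi. Qed.

Lemma projection_entry m n (z : lattice m) (i : 'I_m) :
  first_coords m (first_coords n z) 0 i = if (i < n)%N then z 0 i else 0.
Proof.
case: ltnP => i_n; last exact: first_coords_big.
by rewrite (@first_coordsE _ _ _ i (Ordinal i_n))// (@first_coordsE _ _ _ _ i).
Qed.

Section WalkLaw.
Context (R : realType) (d : measure_display) (T : measurableType d).
Context (P : probability T R) (m : nat) (F : probability (lattice m) R).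
Variables (D : nat -> nat) (S : nat -> {RV P >-> lattice m}).
Hypothesis hF : step_distribution F.
Hypothesis hS : walk_in_varying_dimension F D S.

Lemma discrete_walk k : discrete (S k).
Proof. by move=> A; exact: measurable_funPTI. Qed.

Lemma discrete_increment k : discrete (increment S k).
Proof.
have := discrete_pair (V := 'rV[int]_m) (W := 'rV[int]_m)
  (discrete_walk k.+1) (discrete_walk k).
exact: (discrete_comp (fun p : 'rV[int]_m * 'rV[int]_m => p.1 - p.2)).
Qed.

Lemma increment_indep (J : seq nat) : uniq J ->
  indep_on P (I := nat) (V := 'rV[int]_m) (increment S) J.
Proof.
move=> uJ A; apply: EFin_inj; rewrite prT mul1r setTI.
have mB k : measurable (increment S k @^-1` A k) by exact: discrete_increment.
rewrite -prod_pr// -(walk_indep hS uJ)//.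
rewrite -prE//.
exact: (@measurable_hits _ _ nat 'rV[int]_m _ discrete_increment).
Qed.

Lemma increment_law k (B : set (lattice m)) :
  pr P (increment S k @^-1` B) =
  pr F [set y | B (first_coords m (first_coords (D k) y))].
Proof. by congr fine; exact: (walk_step hS). Qed.

Lemma walk_entry k t i : S k t 0 i = \sum_(l <- iota 0 k) increment S l t 0 i.
Proof.
elim: k => [|k IHk]; first by rewrite big_nil (walk_start hS) mxE.
rewrite -{2}[k.+1]addn1 iotaD big_cat /= add0n big_seq1 -IHk.
by rewrite [increment _ _ _ _ _]mxE mxE addrC subrK.
Qed.

(** The coordinates from D k on are frozen at 0, so that a condition on them is
    either void or impossible; A' encodes this as a condition on the
    unprojected step. *)
Lemma increment_coords k (C : seq 'I_m) (A : 'I_m -> set int) : uniq C ->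
  pr P [set t | forall i, i \in C -> A i (increment S k t 0 i)] =
  \prod_(i <- C) pr P [set t | A i (increment S k t 0 i)].
Proof.
move=> uC.
pose A' i : set int := [set x | A i (if (i < D k)%N then x else 0)].
rewrite (increment_law k [set v | forall i, i \in C -> A i (v 0 i)]).
rewrite (_ : [set y | _] =
  [set y : lattice m | forall i, i \in C -> A' i (y 0 i)]); last first.
  by apply/seteqP; split=> y H i iC; have := H i iC;
    rewrite /A' /= projection_entry.
rewrite (step_coords hF A' uC); apply: eq_bigr => i _.
rewrite (increment_law k [set v | A i (v 0 i)]).
by congr pr; apply/funext => y /=; rewrite projection_entry.
Qed.

End WalkLaw.

(** * Transience caused by three coordinates that move together *)

Lemma infinite_natP (A : set nat) :
  infinite_set A <-> forall k, exists2 l, (k <= l)%N & A l.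
Proof.
split=> [infA k|AP /finite_fsetP[X AX]].
  apply: contrapT => noA; apply: infA; apply: sub_finite_set (finite_II k) => l Al.
  by rewrite /= ltnNge; apply/negP => kl; apply: noA; exists l.
have [l kl Al] := AP (\max_(x <- finmap.enum_fset X) x).+1.
have lX : l \in finmap.enum_fset X by move: Al; rewrite AX.
by have := @leq_bigmax_seq _ _ predT id _ lX isT; rewrite leqNgt kl.
Qed.

Section Transience.
Variable R : realType.

(** With u < v the square roots of consecutive terms, 1/u - 1/v >= x / (2 v^3):
    the sum of the cubes is dominated by a telescoping one. *)
Lemma inv_sqrt_cube_sum (x : R) n : 0 < x ->
  \sum_(i < n.+1) (2 / Num.sqrt (1 + x * i%:R)) ^+ 3 <=
    8 * (1 + 2 / x * (1 - (Num.sqrt (1 + x * n%:R))^-1)).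
Proof.
move=> x0; elim: n => [|n IHn].
  by rewrite big_ord1 mulr0 addr0 sqrtr1 invr1 subrr; lra.
rewrite big_ord_recr /=; apply: le_trans (lerD IHn (lexx _)) _.
set u := Num.sqrt (1 + x * n%:R); set v := Num.sqrt (1 + x * n.+1%:R).
have n0 : 0 <= x * n%:R by rewrite mulr_ge0// ltW.
have uu : u ^+ 2 = 1 + x * n%:R by rewrite sqr_sqrtr; lra.
have vE : 1 + x * n.+1%:R = 1 + x * n%:R + x by rewrite -addn1 natrD; ring.
have vv : v ^+ 2 = u ^+ 2 + x by rewrite uu -vE sqr_sqrtr; lra.
have u0 : 0 < u by rewrite sqrtr_gt0; lra.
have uv : u <= v by rewrite ler_sqrt; lra.
have v0 : 0 < v by lra.
have step : x / (2 * v ^+ 3) <= u^-1 - v^-1.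
  rewrite (_ : u^-1 - v^-1 = (v ^+ 2 - u ^+ 2) / (u * v * (u + v))); last first.
    by field; rewrite !gt_eqF//; lra.
  rewrite vv addrAC subrr add0r (ler_pM2l x0) lef_pV2 ?posrE.
  - have : u * v * (u + v) <= v * v * (v + v).
      by apply: ler_pM; rewrite ?mulr_ge0 ?ler_wpM2r ?lerD ?addr_ge0//; lra.
    by rewrite (_ : v ^+ 3 = v * v * v); [lra|ring].
  - by rewrite ?mulr_gt0 ?exprn_gt0 ?addr_gt0.
  - by rewrite ?mulr_gt0 ?exprn_gt0 ?addr_gt0.
have {}step : 1 / v ^+ 3 <= 2 / x * (u^-1 - v^-1).
  have := ler_wpM2l (_ : 0 <= 2 / x) step; rewrite ltW ?divr_gt0// => /(_ isT).
  rewrite (_ : 2 / x * (x / (2 * v ^+ 3)) = 1 / v ^+ 3)//.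
  by field; rewrite !gt_eqF.
by rewrite expr_div_n (_ : 2 ^+ 3 = 8 :> R); [lra|ring].
Qed.

Context (d : measure_display) (T : measurableType d) (P : probability T R).

Lemma borel_cantelli_ae (A : nat -> set T) (M : R) :
  (forall n, measurable (A n)) ->
  (forall n, \sum_(i < n) pr P (A i) <= M) ->
  P.-negligible [set t | infinite_set [set n | A n t]].
Proof.
move=> mA AM; exists (lim_sup_set A); split.
- apply: bigcap_measurable => // n _; exact: bigcup_measurable.
- apply: lim_sup_set_cvg0 => //.
  apply: (@le_lt_trans _ _ M%:E); last exact: ltry.
  apply: lime_le; first exact: is_cvg_nneseries.
  apply: nearW => n; rewrite big_mkord.
  rewrite (eq_bigr (fun i : 'I_n => (pr P (A i))%:E)) => [|i _]; last exact: prE.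
  rewrite sumEFin lee_fin; exact: AM.
- move=> t /infinite_natP inf n _; have [l nl Al] := inf n; by exists l.
Qed.

Context (m : nat) (F : probability (lattice m) R).
Variables (D : nat -> nat) (S : nat -> {RV P >-> lattice m}).
Hypothesis hF : step_distribution F.
Hypothesis hS : walk_in_varying_dimension F D S.

Variables (C : seq 'I_m) (act : nat -> bool).
Hypotheses (uC : uniq C) (C3 : size C = 3%N).
Hypothesis actE : forall k i, i \in C -> (i < D k)%N = act k.
Hypothesis act_io : infinite_set [set k | act k].

Let c k := count act (iota 0 k).

Let cS k : c k.+1 = (c k + act k)%N.
Proof. by rewrite /c -addn1 iotaD count_cat /= add0n addn0. Qed.

Let c_mono : {homo c : k l / (k <= l)%N}.
Proof.
by apply: homo_leq => [//|k l j|k]; [exact: leq_trans|rewrite cS leq_addr].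
Qed.

Let c_surj n : exists k, c k == n.
Proof.
elim: n => [|n [k /eqP ck]]; first by exists 0%N.
have /infinite_natP/(_ k)[l kl al] := act_io.
have ex : exists j, (n < c j)%N.
  by exists l.+1; rewrite cS (_ : act l = true)// addn1 ltnS -ck c_mono.
case: (ex_minnP ex) => -[|j] //= nj jmin; exists j.+1.
have : (c j <= n)%N by rewrite leqNgt; apply/negP => /jmin; rewrite ltnn.
by move: nj; rewrite cS; case: (act j); lia.
Qed.

Let h0 : exists2 x : R, 0 < x & forall i, i \in C -> exists a b : int,
  [/\ a != b, x <= pr F [set y : lattice m | y 0 i = a] &
      x <= pr F [set y : lattice m | y 0 i = b]].
Proof.
elim: C => [|i s [x x0 IH]]; first by exists 1.
have [a [b [ab a0 b0]]] := coord_two_atoms hF i.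
exists (Num.min x (Num.min (pr F [set y : lattice m | y 0 i = a])
  (pr F [set y : lattice m | y 0 i = b]))); first by rewrite !lt_min x0 a0 b0.
move=> j; rewrite inE => /predU1P[->|/IH[a' [b' [ab' a1 b1]]]].
  by exists a, b; split=> //; rewrite !ge_min lexx ?orbT.
by exists a', b'; split=> //; rewrite ge_min ?a1 ?b1.
Qed.

Let zeroC k := [set t | forall i, i \in C -> S k t 0 i = 0].

Let mzeroC k : measurable (zeroC k).
Proof.
exact: (discrete_walk S k
  [set v : lattice m | forall i, i \in C -> v 0 i = 0]).
Qed.

(** The three coordinates are independent walks making c k effective steps up
    to time k, so that by [concentration] each of them is at 0 with
    probability at most of order (c k)^(-1/2). *)
Lemma coordinate_return_prob : exists2 x : R, 0 < x & forall k,
  pr P (zeroC k) <= (2 / Num.sqrt (1 + x * (c k)%:R)) ^+ 3.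
Proof.
have [x x0 Hx] := h0; exists (2 / 3 * x) => [|k]; first by lra.
rewrite (_ : zeroC k = [set t | forall i, i \in C ->
    \sum_(l <- iota 0 k) increment S l t 0 i = 0]); last first.
  by apply/seteqP; split=> t H i iC; have := H i iC; rewrite (walk_entry hS).
rewrite (coordinate_sums (Y := increment S) (discrete_increment S)
  (iota_uniq 0 k) uC (increment_indep hS (iota_uniq 0 k)) _ (fun=> 0)); last first.
  by move=> l A _; exact: (increment_coords hF hS l A uC).
have -> (y : R) : y ^+ 3 = \prod_(i <- C) y.
  by rewrite big_const_seq count_predT C3 iter_mulr_1.
rewrite big_seq [leRHS]big_seq; apply: ler_prod => i iC; rewrite pr_ge0 /=.
have [a [b [ab ha hb]]] := Hx i iC.
have iE : indep_on P (fun l t => increment S l t 0 i) (iota 0 k).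
  exact: (indep_comp (fun _ => (fun v : 'rV[int]_m => v 0 i))
    (increment_indep hS (iota_uniq 0 k))).
have law l z : act l -> pr P ((fun t => increment S l t 0 i) @^-1` [set z]) =
    pr F [set y : lattice m | y 0 i = z].
  move=> al; rewrite (increment_law hS l [set v : lattice m | v 0 i = z]).
  by congr pr; apply/funext => y /=; rewrite projection_entry actE// al.
have := @concentration _ _ _ P _ (fun l t => increment S l t 0 i)
  (fun l => x * (act l)%:R) a b (iota 0 k) 0 _ (iota_uniq 0 k) iE ab.
rewrite -mulr_sumr -natr_sum (_ : \sum_(l <- iota 0 k) act l = c k)%N; last first.
  by rewrite /c -sum1_count [RHS]big_mkcond; apply: eq_bigr => l _; case: act.
rewrite mulrA; apply.
- by move=> l; exact: (discrete_comp (fun v : 'rV[int]_m => v 0 i)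
    (discrete_increment S l)).
- by move=> l _; rewrite mulr_ge0// ltW.
- by move=> l _; case al : (act l); rewrite ?mulr1 ?mulr0 ?pr_ge0// law.
- by move=> l _; case al : (act l); rewrite ?mulr1 ?mulr0 ?pr_ge0// law.
Qed.

(** Between two steps that move C, the coordinates in C are almost surely
    constant. It suffices therefore to look at one time for each number n of
    such steps; the probabilities of being at 0 then are of order at most
    n^(-3/2), hence summable, and each n accounts for finitely many times
    only, as the steps that move C never stop. *)
Lemma transient_of_gap : transient S.
Proof.
have [x x0 Hx] := coordinate_return_prob.
pose kk n := projT1 (cid (c_surj n)).
have kkE n : c (kk n) = n by apply/eqP; exact: (projT2 (cid (c_surj n))).
have BC := @borel_cantelli_ae (zeroC \o kk) (8 * (1 + 2 / x)) (fun n => mzeroC _).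
have {}BC : P.-negligible [set t | infinite_set [set n | zeroC (kk n) t]].
  apply: BC => -[|n]; first by rewrite big_ord0 mulr_ge0 ?addr_ge0 ?divr_ge0 ?ltW.
  apply: (@le_trans _ _ (\sum_(i < n.+1) (2 / Num.sqrt (1 + x * i%:R)) ^+ 3)).
    by apply: ler_sum => i _ /=; rewrite -{2}(kkE i).
  apply: le_trans (inv_sqrt_cube_sum n x0) _.
  have x2 : 0 <= 2 / x by rewrite divr_ge0// ltW.
  by rewrite ler_wpM2l// lerD2l ler_piMr// lerBlDr lerDl invr_ge0 sqrtr_ge0.
pose Z k := if act k then set0 else
  [set t | ~ forall i, i \in C -> increment S k t 0 i = 0].
have Z0 : P.-negligible (\bigcup_k Z k).
  apply: negligible_bigcup => k; rewrite /Z; case: ifP => ak.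
    exact: negligible_set0.
  have mZ : measurable [set t | ~ forall i, i \in C -> increment S k t 0 i = 0].
    exact: (discrete_increment S k
      [set v : lattice m | ~ forall i, i \in C -> v 0 i = 0]).
  apply/negligibleP => //; apply: etrans (prE P mZ) _.
  rewrite (increment_law hS k [set v : lattice m | ~ forall i, i \in C -> v 0 i = 0]).
  rewrite (_ : [set y | _] = set0) ?pr0//.
  apply/seteqP; split=> // y /=; apply => i iC.
  by rewrite projection_entry actE// ak.
apply: negligibleS (negligibleU BC Z0) => t /= infS.
apply: contrapT => /not_orP[fin noZ]; apply: infS.
have inact k i : ~~ act k -> i \in C -> increment S k t 0 i = 0.
  move=> /negPf ak iC; apply: contrapT => ne; apply: noZ; exists k => //.
  by rewrite /Z ak => /= /(_ i iC).
have cst i k l : i \in C -> (k <= l)%N -> c k = c l -> S k t 0 i = S l t 0 i.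
  move=> iC /subnKC <-; elim: (l - k)%N => [|j IHj] ckl; first by rewrite addn0.
  rewrite addnS in ckl *.
  have := c_mono (leq_addr j k); have := c_mono (leqnSn (k + j)).
  move=> c1 c2; have ckj : c k = c (k + j)%N by lia.
  have naj : ~~ act (k + j)%N by apply/negP => aj; move: ckl; rewrite cS aj; lia.
  rewrite IHj//; have := inact _ _ naj iC.
  by rewrite /increment !mxE => /eqP; rewrite subr_eq0 => /eqP.
have [n0 Hn0] : exists n0, forall n, zeroC (kk n) t -> (n < n0)%N.
  apply: contrapT => no; apply: fin; apply/infinite_natP => k.
  apply: contrapT => nok; apply: no; exists k => n zn.
  by rewrite ltnNge; apply/negP => kn; apply: nok; exists n.
apply: sub_finite_set (finite_II (kk n0)) => k /= Sk0.
rewrite ltnNge; apply/negP => /c_mono; rewrite kkE leqNgt => /negP; apply.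
apply: Hn0 => i iC.
have [le|/ltnW le] := leqP k (kk (c k)).
  by rewrite -(cst i _ _ iC le) ?kkE// Sk0 mxE.
by rewrite (cst i _ _ iC le) ?kkE// Sk0 mxE.
Qed.

End Transience.

(** * Large gaps *)

Section Dimensions.
Variables (N : nat) (dim : nat -> nat).
Hypothesis dim_incr : forall j, (1 <= j < N)%N -> (dim j < dim j.+1)%N.

Lemma dim_mono j k : (1 <= j <= k)%N -> (k <= N)%N -> (dim j <= dim k)%N.
Proof.
move=> /andP[j1 /subnKC <-]; elim: (k - j)%N => [|l IHl] jlN; first by rewrite addn0.
rewrite addnS in jlN *; apply: leq_trans (IHl (ltnW jlN)) _.
by apply/ltnW/dim_incr; lia.
Qed.

End Dimensions.

(** Across a gap of at least 3, the coordinates dim j, dim j + 1 and dim j + 2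
    are moved by exactly the same steps: those of dimension above dim j. *)
Lemma large_gap_transient (R : realType) (N : nat) (dim : nat -> nat)
    (d : measure_display) (T : measurableType d) (P : probability T R)
    (F : probability (lattice (dim N)) R) (D : nat -> nat)
    (S : nat -> {RV P >-> lattice (dim N)}) :
  (forall j, (1 <= j < N)%N -> (dim j < dim j.+1)%N) ->
  ~ (\max_(1 <= j < N) (dim j.+1 - dim j) <= 2)%N ->
  step_distribution F -> walk_in_varying_dimension F D S ->
  interlaces N dim D S -> transient S.
Proof.
move=> dim_incr gap hF hS hI.
have [j jN gj] : exists2 j, (1 <= j < N)%N & (2 < dim j.+1 - dim j)%N.
  apply: contrapT => no; apply: gap; apply/bigmax_leqP_seq => j jN _.
  rewrite leqNgt; apply/negP => gj; apply: no; exists j => //.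
  by move: jN; rewrite mem_index_iota.
have dN : (dim j.+1 <= dim N)%N by apply: (dim_mono dim_incr); lia.
have H0 : (dim j < dim N)%N by lia.
have H1 : (dim j + 1 < dim N)%N by lia.
have H2 : (dim j + 2 < dim N)%N by lia.
pose C := [:: Ordinal H0; Ordinal H1; Ordinal H2].
apply: (transient_of_gap hF hS (C := C) (act := fun k => (dim j < D k)%N)) => //.
- by rewrite /= !inE -!val_eqE /=; lia.
- move=> k i iC.
  have [j' j'N ->] := interlaces_values hI k.
  have iB : (dim j <= i < dim j.+1)%N.
    by move: iC; rewrite !inE -!val_eqE /=; lia.
  have [j'j|jj'] := leqP j' j.
    by have := @dim_mono _ _ dim_incr j' j; lia.
  by have := @dim_mono _ _ dim_incr j.+1 j'; lia.
- have jN' : (1 <= j.+1 <= N)%N by lia.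
  by apply: sub_infinite_set (interlaces_infinitely_often hI jN') => k /= ->; lia.
Qed.

(** * Fair coins *)

Section Coins.
Variable R : realType.

Definition unit_prob : set _ -> \bar R :=
  mrestr (@lebesgue_measure R) (measurable_itv `[0, 1[).

HB.instance Definition _ := Measure.copy unit_prob
  (mrestr (@lebesgue_measure R) (measurable_itv `[0, 1[)).

Lemma unit_prob_setT : unit_prob setT = 1%E.
Proof.
rewrite /unit_prob /mrestr setTI lebesgue_measure_itv /= lte_fin ltr01.
by rewrite oppr0 adde0.
Qed.

HB.instance Definition _ := Measure_isProbability.Build _ _ _ unit_prob
  unit_prob_setT.

Let P : probability _ R := unit_prob.

(** The rank of the dyadic interval of length 2^-n that contains x. *)
Definition cell (n : nat) (x : measurableTypeR R) : nat :=
  Num.truncn (2 ^+ n * (x : R)).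

Lemma cell_gt n x u : (u < cell n x)%N = (u.+1%:R / 2 ^+ n <= x).
Proof. by rewrite truncn_gt_nat ler_pdivrMr ?exprn_gt0// mulrC. Qed.

Lemma discrete_cell n : discrete (cell n).
Proof.
have mgt u : measurable [set x | (u < cell n x)%N].
  rewrite (_ : [set x | _] = `[u.+1%:R / 2 ^+ n, +oo[%classic).
    exact: measurable_itv.
  by apply/seteqP; split=> x /=; rewrite in_itv /= andbT cell_gt.
apply: discrete_points => -[|u].
  rewrite (_ : _ @^-1` _ = ~` [set x | (0 < cell n x)%N]).
    exact: measurableC.
  by apply/seteqP; split=> x /=; rewrite lt0n; case: eqP.
rewrite (_ : _ @^-1` _ =
    [set x | (u < cell n x)%N] `\` [set x | (u.+1 < cell n x)%N]).
  exact: measurableD.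
apply/seteqP; split=> x /=; first by move=> ->; rewrite ltnn; split.
by move=> [ux /negP]; rewrite -leqNgt => xu; apply/eqP; rewrite eqn_leq xu.
Qed.

Lemma cell_half n x : cell n x = (cell n.+1 x)./2.
Proof.
have H u : (u < cell n x)%N = (u < (cell n.+1 x)./2)%N.
  rewrite gtn_half_double cell_gt cell_gt; congr (_ <= x).
  by rewrite exprS -doubleS -mul2n natrM; field; rewrite expf_neq0.
by apply/eqP; rewrite eqn_leq; apply/andP; split;
  rewrite leqNgt ?H ?ltnn// -H ltnn.
Qed.

Lemma pr_cell n K : pr P (cell n @^-1` [set K]) =
  if (K < 2 ^ n)%N then (2 ^+ n)^-1 else 0.
Proof.
have n0 : 0 < 2 ^+ n :> R by rewrite exprn_gt0.
have cellP x : 0 <= x -> (cell n x = K) <->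
    (K%:R / 2 ^+ n <= x < K.+1%:R / 2 ^+ n).
  move=> x0; rewrite ler_pdivrMr// ltr_pdivlMr// [x * _]mulrC.
  have y0 : 0 <= 2 ^+ n * x by rewrite mulr_ge0// ltW.
  by rewrite -truncn_eq//; split=> [/eqP|/eqP].
rewrite /pr /P /= /unit_prob /mrestr; case: ltnP => Kn.
  rewrite (_ : _ `&` _ = `[K%:R / 2 ^+ n, K.+1%:R / 2 ^+ n[%classic).
    rewrite lebesgue_measure_itv /= lte_fin ltr_pM2r ?invr_gt0// ltr_nat ltnSn.
    by rewrite -EFinD /= -mulrBl -addn1 natrD addrAC subrr add0r mul1r.
  apply/seteqP; split=> x /=; rewrite !in_itv /=.
    by move=> [xK /andP[x0 x1]]; apply/cellP.
  move=> /[dup] /andP[xl xr] H.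
  have x0 : 0 <= x by apply: le_trans xl; rewrite divr_ge0// ltW.
  split; first exact/cellP.
  rewrite x0 /=; apply: lt_le_trans xr _.
  by rewrite ler_pdivrMr// mul1r -natrX ler_nat.
rewrite (_ : _ `&` _ = set0) ?measure0//; apply/seteqP; split=> // x /=.
rewrite in_itv /= => -[+ /andP[x0 x1]] => /(cellP _ x0)/andP[+ _].
rewrite leNgt => /negP; apply; apply: lt_le_trans x1 _.
by rewrite ler_pdivlMr// mul1r -natrX ler_nat.
Qed.

(** The binary digits of a uniform point of the unit interval are independent
    fair coins. *)
Definition coin (n : nat) (x : measurableTypeR R) : bool := odd (cell n.+1 x).

Lemma discrete_coin n : discrete (coin n).
Proof. exact: (discrete_comp odd (discrete_cell n.+1)). Qed.

(** Each digit splits every dyadic interval of the preceding level into two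
    halves. *)
Lemma coin_after_cell n (B : set nat) (b : bool) :
  pr P ([set x | B (cell n x)] `&` coin n @^-1` [set b]) =
  2^-1 * pr P [set x | B (cell n x)].
Proof.
have mB : measurable [set x | B (cell n x)] by exact: (discrete_cell n B).
have mc := discrete_cell n.
apply: (@slice_eq _ _ _ P _ _ _ _ (cell n) (cell n)) => //.
  by apply: measurableI => //; exact: discrete_coin.
move=> K; have [BK|nBK] := pselect (B K); last first.
  rewrite (_ : _ `&` _ `&` _ = set0); last first.
    by apply/seteqP; split=> // x [[/= Bx _] xK]; apply: nBK; rewrite -xK.
  rewrite (_ : _ `&` _ = set0) ?pr0 ?mulr0//.
  by apply/seteqP; split=> // x [/= Bx xK]; apply: nBK; rewrite -xK.
rewrite (_ : _ `&` _ `&` _ = cell n.+1 @^-1` [set (b + K.*2)%N]); last first.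
  apply/seteqP; split=> x /=.
    by move=> [[_ <-] <-]; rewrite /coin (cell_half n) odd_double_half.
  move=> xE; rewrite /coin (cell_half n) xE oddD odd_double addbF oddb.
  by rewrite half_bit_double.
rewrite (_ : _ `&` _ = cell n @^-1` [set K]); last first.
  by apply/seteqP; split=> x /=; [move=> []|move=> xK; rewrite xK; split].
rewrite !pr_cell expnS (_ : (b + K.*2 < 2 * 2 ^ n)%N = (K < 2 ^ n)%N); last first.
  by rewrite -mul2n; case: b; lia.
by case: ifP => _; rewrite ?mulr0// exprS invfM.
Qed.

Lemma pr_coin n b : pr P (coin n @^-1` [set b]) = 2^-1.
Proof.
have := coin_after_cell n setT b.
by rewrite (_ : [set x | setT _] = setT) ?prT ?mulr1 ?setTI//; apply/seteqP; split.
Qed.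

Lemma coin_indep J : uniq J -> indep_on P coin J.
Proof.
move=> uJ.
suff H n : indep_on P coin (iota 0 n).
  apply: (indep_given_sub uJ (iota_uniq 0 (\max_(k <- J) k).+1) _ (H _)).
  by move=> k kJ; rewrite mem_iota add0n ltnS (@leq_bigmax_seq _ _ predT id).
elim: n => [|n IHn] A.
  rewrite big_nil mulr1 prT (_ : hits _ _ _ = setT) ?setTI ?prT//.
  by apply/seteqP; split.
rewrite prT mul1r setTI -addn1 iotaD hits_cat big_cat /= add0n big_seq1.
have := IHn A; rewrite prT mul1r setTI => <-.
rewrite hits_seq1.
have coin_cell k x : (k < n)%N -> coin k x = odd (iter (n - k.+1) half (cell n x)).
  move=> kn; rewrite /coin; congr odd; rewrite -{2}(subnKC kn).
  elim: (n - k.+1)%N => [|j IHj]; first by rewrite addn0.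
  by rewrite iterSr addnS -cell_half.
have [B EB] : exists B : set nat, hits coin (iota 0 n) A = [set x | B (cell n x)].
  exists (fun c => forall k, k \in iota 0 n -> A k (odd (iter (n - k.+1) half c))).
  by apply/seteqP; split=> x H k kn; have := H k kn;
    rewrite coin_cell//; move: kn; rewrite mem_iota add0n.
rewrite EB.
have mB : measurable [set x | B (cell n x)] by exact: (discrete_cell n B).
have mcn := discrete_coin n.
apply: (@slice_eq _ _ _ P _ _ _ _ (coin n) (coin n)) => //.
- by apply: measurableI => //; exact: discrete_coin.
- exact: pr_ge0.
move=> b; have [Ab|nAb] := pselect (A n b).
  rewrite -setIA (_ : coin n @^-1` A n `&` _ = coin n @^-1` [set b]).
    by rewrite coin_after_cell pr_coin mulrC.
  by apply/seteqP; split=> x /=; [move=> []|move=> ->].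
rewrite -setIA (_ : coin n @^-1` A n `&` _ = set0) ?setI0 ?pr0 ?mulr0//.
by apply/seteqP; split=> // x /= [+ xb]; rewrite xb.
Qed.

End Coins.

(** * Walks with random signs *)

(** The i-th basis vector is half the difference of two sign vectors that
    differ only at i. *)
Lemma truly_dimensional_signs (R : realType) n (mu : set (lattice n) -> \bar R) :
  (forall (v : lattice n) (A : set (lattice n)),
     (forall i, v 0 i = 1 \/ v 0 i = -1) -> A v -> mu A <> 0%E) ->
  truly_dimensional mu.
Proof.
move=> mu_pos V muV.
have signV (v : lattice n) : (forall i, v 0 i = 1 \/ v 0 i = -1) ->
    map_mx intr (v : 'rV[int]_n) \in V.
  move=> sv; apply: contrapT => vV; apply: (mu_pos v _ sv _ muV).
  exact/negP.
apply/vspaceP => x; rewrite memvf.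
rewrite (row_sum_delta x); apply: memv_suml => i _; apply: memvZ.
pose v1 : lattice n := const_mx 1.
pose v2 : lattice n := \row_j (if j == i then -1 else 1).
rewrite (_ : delta_mx 0 i = 2^-1 *:
  (map_mx intr (v1 : 'rV[int]_n) - map_mx intr (v2 : 'rV[int]_n))).
  apply/memvZ/memvB; apply: signV => j; rewrite !mxE; first by left.
  by case: eqP; [right|left].
apply/rowP => j; rewrite !mxE eqxx /=.
by case: eqP => _; rewrite /= ?subrr ?mulr0// opprK -(natrD _ 1 1) mulVf.
Qed.

Section SignVectors.
Context (R : realType) (d : measure_display) (T : measurableType d).
Context (P : probability T R) (c : nat -> T -> bool) (m : nat).
Hypothesis mc : forall n, discrete (c n).
Hypothesis c_indep : forall J, uniq J -> indep_on P c J.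
Hypothesis c_fair : forall n b, pr P (c n @^-1` [set b]) = 2^-1.

Definition sign_of (b : bool) : int := if b then 1 else -1.

(** Different vectors read disjoint blocks of m coins, hence are independent. *)
Definition signs (k : nat) (t : T) : lattice m :=
  \row_(i < m) sign_of (c (k * m + i)%N t).

Let coins k := [seq (k * m + i)%N | i <- iota 0 m].

Let signs_of (s : seq bool) : lattice m := \row_(i < m) sign_of (nth false s i).

Let signsE k t : signs k t = signs_of (map (c^~ t) (coins k)).
Proof.
apply/rowP => i; rewrite !mxE -map_comp (nth_map 0%N) ?size_iota//=.
by rewrite nth_iota.
Qed.

Lemma discrete_signs k : discrete (signs k).
Proof.
move=> A.
have := measurable_event mc [set s | A (signs_of s)] (coins k).
by congr measurable; apply/funext => t /=; rewrite -signsE.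
Qed.

Let index_inj k i k' i' : (i < m)%N -> (i' < m)%N ->
  (k * m + i = k' * m + i')%N -> k = k' /\ i = i'.
Proof.
move=> im i'm e; have m0 : (0 < m)%N by lia.
have ek : k = k'.
  by have := congr1 (divn^~ m) e; rewrite !divnMDl// !divn_small// !addn0.
by split=> //; move: e; rewrite ek => /addnI.
Qed.

Let uniq_coins J : uniq J -> uniq (flatten (map coins J)).
Proof.
move=> uJ.
apply: (@allpairs_uniq _ _ _ (fun k i => (k * m + i)%N) J (iota 0 m)) => //.
  exact: iota_uniq.
move=> [k i] [k' i'] /allpairsP[[? ?] [_ /= iI [-> ->]]].
move=> /allpairsP[[? ?] [_ /= iI' [-> ->]]] /=.
by move: iI iI'; rewrite !mem_iota !add0n => iI iI' /(index_inj iI iI') [-> ->].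
Qed.

Lemma signs_indep J : uniq J ->
  indep_on P (V := 'rV[int]_m) signs J.
Proof.
move=> uJ A; rewrite prT mul1r setTI.
have uF := uniq_coins uJ.
have := @indep_blocks _ _ _ P _ _ c mc _ J coins
  (fun k => [set s | A k (signs_of s)]) uF (c_indep uF).
rewrite (_ : [set t | _] = hits signs J A); last first.
  by apply/seteqP; split=> t H k kJ; have := H k kJ; rewrite signsE.
move=> ->; apply: eq_bigr => k _; congr pr.
by apply/funext => t /=; rewrite signsE.
Qed.

Lemma signs_law k l (B : set (lattice m)) :
  pr P (signs k @^-1` B) = pr P (signs l @^-1` B).
Proof.
pose r := [seq ((k * m + i)%N, (l * m + i)%N) | i <- iota 0 m].
have r1 : unzip1 r = coins k by rewrite /unzip1 -map_comp.
have r2 : unzip2 r = coins l by rewrite /unzip2 -map_comp.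
have u j : uniq (coins j).
  by have := @uniq_coins [:: j] isT; rewrite /= cats0.
have := @same_law _ _ _ P _ _ _ c c r mc mc; rewrite r1 r2.
move=> /(_ (u k) (u l) (c_indep (u k)) (c_indep (u l)) _ [set s | B (signs_of s)]).
have E j : [set t | [set s | B (signs_of s)] (map (c^~ t) (coins j))] =
    signs j @^-1` B.
  by apply/funext => t /=; rewrite signsE.
by rewrite !E; apply => a b _ v; rewrite !c_fair.
Qed.

Lemma signs_coords k (C : seq 'I_m) (A : 'I_m -> set int) : uniq C ->
  pr P [set t | forall i, i \in C -> A i (signs k t 0 i)] =
  \prod_(i <- C) pr P [set t | A i (signs k t 0 i)].
Proof.
move=> uC; pose L (i : 'I_m) := [:: (k * m + i)%N].
have EL : flatten (map L C) = [seq (k * m + val i)%N | i <- C].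
  by elim: (C) => //= i s ->.
have uL : uniq (flatten (map L C)).
  by rewrite EL map_inj_uniq// => i j /addnI/val_inj.
have := @indep_blocks _ _ _ P _ _ c mc _ C L
  (fun i => [set s | A i (sign_of (head false s))]) uL (c_indep uL).
rewrite (_ : [set t | _] =
    [set t | forall i, i \in C -> A i (signs k t 0 i)]); last first.
  by apply/seteqP; split=> t H i iC; have := H i iC; rewrite !mxE.
move=> ->; apply: eq_bigr => i _; congr pr.
by apply/funext => t /=; rewrite mxE.
Qed.

Lemma pr_signs k i z : pr P [set t | signs k t 0 i = z] =
  if (z == 1) || (z == -1) then 2^-1 else 0.
Proof.
have [->|z1] /= := eqVneq z 1.
  rewrite -(c_fair (k * m + i) true); congr pr.
  by apply/seteqP; split=> t /=; rewrite mxE; case: (c _ _).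
have [->|zm1] /= := eqVneq z (-1).
  rewrite -(c_fair (k * m + i) false); congr pr.
  by apply/seteqP; split=> t /=; rewrite mxE; case: (c _ _).
rewrite (_ : [set t | _] = set0) ?pr0//; apply/seteqP; split=> // t /=.
by rewrite mxE; case: (c _ _) => /esym/eqP; rewrite ?(negPf z1) ?(negPf zm1).
Qed.

Lemma pr_signs_gt0 k (v : lattice m) : (forall i, v 0 i = 1 \/ v 0 i = -1) ->
  0 < pr P (signs k @^-1` [set v]).
Proof.
move=> sv; have := signs_coords k (fun i => [set v 0 i]) (enum_uniq 'I_m).
rewrite (_ : [set t | _] = signs k @^-1` [set v]) => [->|].
  by apply: prodr_gt0 => i _; rewrite pr_signs; case: (sv i) => ->;
    rewrite eqxx ?orbT invr_gt0.
apply/seteqP; split=> t /=; last by move=> ->.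
by move=> H; apply/rowP => i; rewrite H// mem_enum.
Qed.

Lemma signs_or k t i : signs k t 0 i = 1 \/ signs k t 0 i = -1.
Proof. by rewrite mxE; case: (c _ _); [left|right]. Qed.

(** The walk and the step law are built from plain functions on T; this packages
    such a function as a random variable. *)
Definition rv_of (X : T -> lattice m) (mX : discrete X) : {RV P >-> lattice m} :=
  mfun_Sub (mem_set (fun (_ : measurable setT) (A : set (lattice m))
    (_ : measurable A) =>
    measurableI _ _ measurableT (mX A)) : X \in mfun).

Definition sign_law : probability (lattice m) R :=
  distribution P (rv_of (discrete_signs 0)).

Lemma sign_lawE A : sign_law A = P (signs 0 @^-1` A).
Proof. by []. Qed.

Lemma integrable_sign_coord i :
  P.-integrable setT (EFin \o (fun t => (signs 0 t 0 i)%:~R : R)).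
Proof.
apply: measurable_bounded_integrable => //.
- by rewrite ltey_eq fin_num_measure.
- move=> _ A _; rewrite setTI.
  exact: (discrete_signs 0 [set v | A ((v 0 i)%:~R)]).
- exists 1; split=> // M M1 t _ /=.
  by case: (signs_or 0 t i) => ->; rewrite ?rmorphN ?normrN normr1 ltW.
Qed.

Lemma sign_law_mean i : ('E_sign_law[Defs.coord R i] = 0)%E.
Proof.
rewrite unlock (integral_distribution (X := rv_of (discrete_signs 0))) //; last first.
  exact: integrable_sign_coord.
pose A := [set t | signs 0 t 0 i = 1].
have mA : measurable A by exact: (discrete_signs 0 [set v | v 0 i = 1]).
have mA' : measurable (~` A) by exact: measurableC.
rewrite -(setUv A) integral_setU//; last 2 first.
- rewrite setUv.
  have /integrableP[] := integrable_sign_coord i.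
  by [].
- by rewrite disj_set2E setICr.
rewrite (eq_integral (fun=> 1%E)); last first.
  by move=> t; rewrite inE /A /= /Defs.coord => ->.
rewrite [X in (_ + X)%E](eq_integral (fun=> (-1)%:E)); last first.
  move=> t; rewrite inE /A /= /Defs.coord; by case: (signs_or 0 t i) => ->.
have cstE (B : set T) (r : R) : measurable B ->
    (\int[P]_(x in B) r%:E = (r * pr P B)%:E)%E.
  by move=> mB; rewrite integral_cst// EFinM; congr (_ * _)%E; exact: prE.
rewrite !cstE// prC// pr_signs eqxx /= -EFinD; congr EFin; lra.
Qed.

Lemma sign_law_step : step_distribution sign_law.
Proof.
split.
- apply: truly_dimensional_signs => v A sv Av.
  rewrite sign_lawE (prE P (discrete_signs 0 A)) => /eqP.
  rewrite (eqe _ 0) => /eqP e.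
  have := pr_signs_gt0 0 sv; rewrite -e ltNge => /negP; apply.
  apply: le_pr; [exact: discrete_signs|exact: discrete_signs|].
  by move=> t /= ->.
- move=> J A uJ mA.
  have mX i : measurable [set t | A i ((signs 0 t 0 i)%:~R)].
    exact: (discrete_signs 0 [set v | A i ((v 0 i)%:~R)]).
  have mXs : measurable [set t | forall i, i \in J -> A i ((signs 0 t 0 i)%:~R)].
    exact: (discrete_signs 0 [set v | forall i, i \in J -> A i ((v 0 i)%:~R)]).
  have := signs_coords 0 (fun i => [set z | A i (z%:~R : R)]) uJ => H.
  transitivity (P [set t | forall i, i \in J -> A i ((signs 0 t 0 i)%:~R)]).
    by [].
  by rewrite (prE P mXs) H -prod_pr//; apply: eq_bigr.
- move=> i; apply: integrable_pushforward => //; exact: integrable_sign_coord.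
- exact: sign_law_mean.
- move=> i; rewrite /variance unlock sign_law_mean /=.
  rewrite unlock ge0_integral_distribution => //; last first.
    by move=> y; exact: (sqr_ge0 (Defs.coord R i y - fine 0)).
  rewrite (eq_integral (fun=> 1%E)).
    by rewrite integral_cst// mul1e ltey_eq fin_num_measure.
  move=> t _; congr EFin.
  transitivity ((Defs.coord R i (signs 0 t) - 0) * (Defs.coord R i (signs 0 t) - 0)).
    by [].
  rewrite /Defs.coord subr0.
  by case: (signs_or 0 t i) => /= ->; rewrite ?rmorphN ?mulrNN mulr1.
Qed.

End SignVectors.

(** * Last exit and return windows *)

Section FiniteUnions.
Context (R : realType) (d : measure_display) (T : measurableType d).
Context (P : probability T R) (A : nat -> set T).
Hypothesis mA : forall n, measurable (A n).

Let union n := [set t | exists2 i, (i < n)%N & A i t].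

Let union0 : union 0 = set0.
Proof. by apply/seteqP; split=> // t [i]; rewrite ltn0. Qed.

Let unionS n : union n.+1 = union n `|` A n.
Proof.
apply/seteqP; split=> t.
  move=> [i]; rewrite ltnS leq_eqVlt => /predU1P[->|]; first by right.
  by left; exists i.
move=> [[i ni Ai]|An]; last by exists n.
by exists i => //; exact: ltnW.
Qed.

Let munion n : measurable (union n).
Proof.
by elim: n => [|n IHn]; [rewrite union0|rewrite unionS; exact: measurableU].
Qed.

Lemma sum_pr_le1 n : (forall i j t, (i < j < n)%N -> A i t -> ~ A j t) ->
  \sum_(i < n) pr P (A i) <= 1.
Proof.
move=> dis; suff H k : (k <= n)%N -> \sum_(i < k) pr P (A i) = pr P (union k).
  by rewrite H// pr_le1.
elim: k => [|k IHk] kn; first by rewrite big_ord0 union0 pr0.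
rewrite big_ord_recr /= IHk 1?ltnW// unionS prU//.
by apply/seteqP; split=> // t [[i ik Ai]]; apply: (dis i k) => //; rewrite ik.
Qed.

Lemma pr_union_le n : pr P [set t | exists2 i, (i < n)%N & A i t] <=
  \sum_(i < n) pr P (A i).
Proof.
rewrite -/(union n); elim: n => [|n IHn]; first by rewrite big_ord0 union0 pr0.
rewrite big_ord_recr /= unionS -(setDUK (_ : A n `<=` union n `|` A n)); last first.
  by move=> t; right.
have mD : measurable ((union n `|` A n) `\` A n).
  by apply: measurableD => //; exact: measurableU.
rewrite prU//; last by rewrite setDE setIC -setIA setICl setI0.
rewrite addrC lerD2l; apply: le_trans _ IHn; apply: le_pr => //.
by move=> t [[//|]].
Qed.

End FiniteUnions.

Section LastExit.
Context (R : realType) (d : measure_display) (T : measurableType d).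
Context (P : probability T R) (V : countType) (X : nat -> T -> V).
Hypothesis mX : forall n, discrete (X n).
Hypothesis X_indep : forall J, uniq J -> indep_on P X J.
Hypothesis X_law : forall k l v,
  pr P (X k @^-1` [set v]) = pr P (X l @^-1` [set v]).
(** zero s says that the path with steps s ends where it started; its two
    properties are those of the return times of a random walk. *)
Variable zero : set (seq V).
Hypothesis zero_nil : zero [::].
Hypothesis zero_cat : forall s1 s2, zero s1 -> (zero (s1 ++ s2) <-> zero s2).

Local Notation pr := (pr P).
Local Notation path J := (fun t => map (X^~ t) J).

Definition avoids a (s : seq V) :=
  forall k, (a <= k <= size s)%N -> ~ zero (take k s).

(** The law of a list of steps depends only on its length: a walk that makes
    its steps at prescribed times behaves like one that moves all the time. *)
Lemma list_law J (B : set (seq V)) : uniq J ->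
  pr [set t | B (path J t)] = pr [set t | B (path (iota 0 (size J)) t)].
Proof.
move=> uJ; have sz := size_iota 0 (size J).
have := @same_law _ _ _ P _ _ _ X X (zip J (iota 0 (size J))) mX mX.
rewrite unzip1_zip ?sz// unzip2_zip ?sz//; apply => //.
- exact: iota_uniq.
- exact: X_indep.
- exact/X_indep/iota_uniq.
Qed.

Let u n := pr [set t | zero (path (iota 0 n) t)].
Let r n := pr [set t | avoids 1 (path (iota 0 n) t)].
(** The event that the last visit to 0 up to time M takes place at time n. *)
Let exit M n := [set t | zero (path (iota 0 n) t) /\
  avoids 1 (path (iota n (M - n)) t)].

Let mexit M n : measurable (exit M n).
Proof.
exact: measurableI (measurable_event mX zero _)
  (measurable_event mX (avoids 1) _).
Qed.

Let pr_exit M n : (n <= M)%N -> pr (exit M n) = u n * r (M - n).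
Proof.
move=> nM.
have uM : uniq (iota 0 n ++ iota n (M - n)) by rewrite -iotaD iota_uniq.
rewrite /exit -[mkset _]/([set t | _] `&` [set t | _]).
rewrite (indep_two_blocks mX zero (avoids 1) uM (X_indep uM)).
by rewrite [X in _ * X]list_law ?iota_uniq// size_iota.
Qed.

Let path_cat n k t : path (iota 0 (n + k)) t = path (iota 0 n) t ++ path (iota n k) t.
Proof. by rewrite iotaD map_cat. Qed.

Let take_path a n k t : (k <= n)%N -> take k (path (iota a n) t) = path (iota a k) t.
Proof. by move=> kn; rewrite -map_take take_iota (minn_idPl kn). Qed.

(** There is at most one last time at 0. *)
Lemma sum_exit M : \sum_(n < M.+1) u n * r (M - n) <= 1.
Proof.
have H := @sum_pr_le1 _ _ _ P (exit M) (mexit M) M.+1.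
rewrite (eq_bigr (fun n : 'I_M.+1 => pr (exit M n))); last first.
  by move=> n _; rewrite pr_exit// -ltnS.
apply: H => i j t /andP[ij jM] [zi ai] [zj _]; rewrite ltnS in jM.
apply: (ai (j - i)%N); first by rewrite size_map size_iota subn_gt0 ij leq_sub2r.
rewrite take_path ?leq_sub2r//.
by move: zj; rewrite -{1}(subnKC (ltnW ij)) path_cat zero_cat.
Qed.

(** A path that is not at 0 between s and M is last at 0 at some n < s. *)
Lemma avoids_le_exit s M : (0 < s <= M)%N ->
  pr [set t | avoids s (path (iota 0 M) t)] <= \sum_(n < s) u n * r (M - n).
Proof.
move=> /andP[s0 sM].
rewrite (eq_bigr (fun n : 'I_s => pr (exit M n))); last first.
  by move=> n _; rewrite pr_exit// ltnW// (leq_trans (ltn_ord n)).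
apply: le_trans _ (pr_union_le P (mexit M) s).
apply: le_pr => [||t av].
- exact: measurable_event.
- rewrite (_ : mkset _ = \bigcup_(i in `I_s) exit M i).
    exact: bigcup_measurable.
  by apply/seteqP; split=> t [i]; exists i.
pose Z n := (n < s)%N && `[<zero (path (iota 0 n) t)>].
have exZ : exists n, Z n by exists 0%N; rewrite /Z s0 /=; apply/asboolP.
have ubZ n : Z n -> (n <= s)%N by move=> /andP[/ltnW].
case: (ex_maxnP exZ ubZ) => n /andP[ns /asboolP zn] nmax.
exists n => //; split=> // k; rewrite size_map size_iota => /andP[k1 kM].
rewrite take_path// => zk.
have znk : zero (path (iota 0 (n + k)) t) by rewrite path_cat zero_cat.
have [nks|snk] := ltnP (n + k) s.
  have := nmax (n + k)%N; rewrite /Z nks asboolT// => /(_ isT); lia.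
have nkM : (n + k <= M)%N by lia.
apply: (av (n + k)%N); first by rewrite size_map size_iota snk.
by rewrite take_path.
Qed.

Lemma r_anti L L' : (L <= L')%N -> r L' <= r L.
Proof.
move=> LL; apply: le_pr => [||t av k]; try exact: measurable_event.
rewrite size_map size_iota => /andP[k1 kL].
have := av k; rewrite size_map size_iota k1 (leq_trans kL LL) => /(_ isT).
by rewrite !take_path// (leq_trans kL LL).
Qed.

(** By [sum_exit] and the monotonicity of r, r L is at most the inverse of the
    expected number of times at 0 up to L; by [avoids_le_exit] the
    probability on the left is at most s (r L). This quantitative form of
    recurrence does not depend on where the steps sit in time. *)
Lemma avoids_prob J s L : uniq J -> (0 < s)%N -> size J = (s + L)%N ->
  pr [set t | avoids s (path J t)] *
    (\sum_(n < L.+1) pr [set t | zero (path (iota 0 n) t)]) <= s%:R.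
Proof.
move=> uJ s0 sJ; rewrite list_law// sJ.
have u0 n : 0 <= u n by exact: pr_ge0.
have u1 n : u n <= 1 by apply: pr_le1; exact: measurable_event.
have r0 n : 0 <= r n by exact: pr_ge0.
have a1 : pr [set t | avoids s (path (iota 0 (s + L)) t)] <= s%:R * r L.
  apply: le_trans (@avoids_le_exit s (s + L) _) _; first by rewrite s0 leq_addr.
  rewrite mulr_natl -[X in r L *+ X]card_ord -sumr_const.
  apply: ler_sum => n _; rewrite -[leRHS]mul1r ler_pM// r_anti//.
  by have := ltn_ord n; lia.
have a2 : r L * \sum_(n < L.+1) u n <= 1.
  apply: le_trans (sum_exit L); rewrite mulr_sumr; apply: ler_sum => n _.
  by rewrite mulrC ler_wpM2l// r_anti// leq_subr.
have U0 : 0 <= \sum_(n < L.+1) u n by apply: sumr_ge0.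
apply: le_trans (ler_wpM2r U0 a1) _.
by rewrite -mulrA -[leRHS]mulr1 ler_wpM2l.
Qed.

End LastExit.

Section ReturnWindow.
Context (R : realType) (d : measure_display) (T : measurableType d).
Context (P : probability T R) (c : nat -> T -> bool) (m : nat).
Hypothesis mc : forall n, discrete (c n).
Hypothesis c_indep : forall J, uniq J -> indep_on P c J.
Hypothesis c_fair : forall n b, pr P (c n @^-1` [set b]) = 2^-1.

Local Notation pr := (pr P).
Local Notation signs := (@signs d T c m).

Let mX : forall k, discrete (signs k) := discrete_signs mc.
Let X_indep J (uJ : uniq J) := signs_indep (m := m) mc c_indep uJ.

Definition null_on (C : seq 'I_m) : set (seq 'rV[int]_m) :=
  [set s : seq 'rV[int]_m | forall i, i \in C -> \sum_(w <- s) w 0 i = 0].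

Lemma null_on_nil C : null_on C [::].
Proof. by move=> i _; rewrite big_nil. Qed.

Lemma null_on_cat C s1 s2 : null_on C s1 -> (null_on C (s1 ++ s2) <-> null_on C s2).
Proof.
move=> n1; split=> H i iC; have := H i iC; rewrite big_cat /= n1// add0r//.
Qed.

(** Each coordinate of the walk is a sum of fair choices between -1 and 1. *)
Lemma sign_walk_law i J z : uniq J ->
  pr [set t | \sum_(k <- J) signs k t 0 i = z] =
  bin_avg (-1) 1 (size J) (fun y => (y == 0)%:R) z.
Proof.
pose Y k t : int := signs k t 0 i.
have mY k : discrete (Y k).
  exact: (discrete_comp (fun v : 'rV[int]_m => v 0 i) (mX k)).
elim: J z => [|k J IHJ] z uJ.
  by rewrite bin_avg0; exact: (pr_sum_nil P Y).
have /andP[kJ uJ'] := uJ.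
have iY : indep_on P Y (k :: J).
  exact: (indep_comp (fun _ => (fun v : 'rV[int]_m => v 0 i)) (X_indep uJ)).
have cut v : v = 1 \/ v = -1 ->
    pr ([set t | \sum_(k <- k :: J) Y k t = z] `&` Y k @^-1` [set v]) =
    2^-1 * bin_avg (-1) 1 (size J) (fun y => (y == 0)%:R) (z - v).
  move=> v1; rewrite (pr_sum_cons mY _ _ uJ iY) -IHJ//; congr (_ * _).
  by rewrite pr_signs// (_ : _ || _ = true)//; case: v1 => ->; rewrite eqxx ?orbT.
rewrite /= bin_avgS mulrDl ![_ / 2]mulrC -!cut; [|by left|by right].
rewrite -prU.
- congr pr; apply/seteqP; split=> t /=; last by move=> [[]|[]].
  by move=> St; case: (signs_or c k t i) => H; [right|left]; split.
- by apply: measurableI; [exact: measurable_sum|exact: mY].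
- by apply: measurableI; [exact: measurable_sum|exact: mY].
- by apply/seteqP; split=> // t [[_ /= ->] [_ /=]].
Qed.

(** One coordinate is back at 0 after 2n steps with probability
    C(2n, n) / 4^n >= (4n)^(-1/2), and there are at most two coordinates. *)
Lemma return_prob (C : seq 'I_m) n : uniq C -> (size C <= 2)%N ->
  (4 * n.+1%:R)^-1 <=
  pr [set t | null_on C (map (signs^~ t) (iota 0 n.+1.*2))].
Proof.
move=> uC C2; set p : R := bin_avg (-1) 1 n.+1.*2 (fun y => (y == 0)%:R) 0.
have p_ge : 'C(n.+1.*2, n.+1)%:R / 2 ^+ n.+1.*2 <= p.
  have nn : (n.+1 < n.+1.*2.+1)%N by rewrite ltnS -addnn leq_addr.
  rewrite /p /bin_avg (bigD1 (Ordinal nn)) //=.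
  have cancel k : 0 - (-1 : int) *+ k.*2 - (1 - -1) *+ k = 0.
    by elim: k => [//|k IHk]; rewrite doubleS !mulrS -[RHS]IHk; ring.
  rewrite cancel.
  rewrite eqxx mulr1 lerDl; apply: sumr_ge0 => i _.
  by rewrite mulr_ge0 ?divr_ge0 ?exprn_ge0.
have p0 : 0 <= p by apply: bin_avg_delta_ge0.
have uI := iota_uniq 0 n.+1.*2.
have -> : pr [set t | null_on C (map (signs^~ t) (iota 0 n.+1.*2))] = p ^+ size C.
  transitivity (pr [set t | forall i, i \in C ->
      \sum_(k <- iota 0 n.+1.*2) signs k t 0 i = 0]).
    by congr pr; apply/seteqP; split=> t H i iC; have := H i iC; rewrite big_map.
  rewrite (coordinate_sums mX uI uC (X_indep uI) _ (fun=> 0)); last first.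
    by move=> k A _; exact: signs_coords.
  under eq_bigr do rewrite sign_walk_law// size_iota -/p.
  by rewrite big_const_seq count_predT iter_mulr_1.
have p1 : p <= 1.
  by apply: bin_avg_le => y; rewrite (ler_nat _ _ 1) leq_b1.
have p2 : p ^+ 2 <= p ^+ size C by rewrite ler_wiXn2l.
apply: le_trans p2.
have q0 : 0 <= 'C(n.+1.*2, n.+1)%:R / 2 ^+ n.+1.*2 :> R.
  by rewrite divr_ge0 ?exprn_ge0.
apply: (@le_trans _ _ (('C(n.+1.*2, n.+1)%:R / 2 ^+ n.+1.*2) ^+ 2)); last first.
  by rewrite ler_sqr ?nnegrE.
rewrite expr_div_n ler_pdivlMr ?exprn_gt0// mulrC ler_pdivrMr ?mulr_gt0//.
have -> : (2 ^+ n.+1.*2) ^+ 2 = (16 ^ n.+1)%:R :> R.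
  by rewrite -exprM muln2 -!mul2n mulnA (exprM 2 (2 * 2)) natrX -(natrX _ 2 (2 * 2)).
by rewrite -natrX -!natrM ler_nat; exact: central_bin_lower.
Qed.

Lemma sum_return_prob (C : seq 'I_m) L : uniq C -> (size C <= 2)%N ->
  series harmonic L / 4 <=
  \sum_(n < L.*2.+1) pr [set t | null_on C (map (signs^~ t) (iota 0 n))].
Proof.
move=> uC C2; elim: L => [|L IHL].
  by rewrite /series /= big_geq// mul0r; apply: sumr_ge0 => n _; exact: pr_ge0.
rewrite /series /= big_nat_recr //= mulrDl doubleS.
rewrite big_ord_recr big_ord_recr /= -addrA; apply: lerD; first exact: IHL.
apply: ler_wpDl; first exact: pr_ge0.
by rewrite -invfM mulrC; exact: return_prob.
Qed.

End ReturnWindow.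

Lemma harmonic_unbounded (R : realType) (K : R) :
  exists L, K <= series (@harmonic R) L.
Proof.
apply: contrapT => no; apply: (@dvg_harmonic R).
apply: nondecreasing_is_cvgn.
  by apply: nondecreasing_series => n _ _; exact: harmonic_ge0.
exists K => _ [L _ <-]; rewrite leNgt; apply/negP => /ltW KL.
by apply: no; exists L.
Qed.

(** The expected number of returns diverges like the harmonic series, so
    [avoids_prob] becomes small. It matters that L is the same for all P, C and
    J: the windows have to be fixed before the walk is built. *)
Lemma return_window (R : realType) (s : nat) (e : R) : (0 < s)%N -> 0 < e ->
  exists2 L, (0 < L)%N & forall (d : measure_display) (T : measurableType d)
    (P : probability T R) (c : nat -> T -> bool) (m : nat)
    (C : seq 'I_m) (J : seq nat),
  (forall n, discrete (c n)) -> (forall J, uniq J -> indep_on P c J) ->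
  (forall n b, pr P (c n @^-1` [set b]) = 2^-1) ->
  uniq C -> (size C <= 2)%N -> uniq J -> size J = (s + L.*2)%N ->
  pr P [set t | avoids (null_on C) s (map ((signs c m)^~ t) J)] <= e.
Proof.
move=> s0 e0; have [L HL] := harmonic_unbounded (4 * (s%:R / e)).
have se : 0 < s%:R / e by rewrite divr_gt0 ?ltr0n.
exists L => [|d T P c m C J mc ic fc uC C2 uJ sJ].
  by case: L HL => // H0; move: H0; rewrite /series /= big_geq//; lra.
have := avoids_prob (P := P) (X := signs c m) (discrete_signs mc)
  (fun J => @signs_indep _ _ _ P c m mc ic J)
  (fun k l v => signs_law mc ic fc k l [set v])
  (@null_on_nil m C) (@null_on_cat m C) uJ s0 sJ.
have := sum_return_prob mc ic fc L uC C2.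
set U := \sum_(n < _) _; set a := pr P _ => UL aU.
have Use : s%:R / e <= U by lra.
have a0 : 0 <= a by exact: pr_ge0.
have : a * (s%:R / e) <= s%:R by apply: le_trans (ler_wpM2l a0 Use) aU.
by rewrite mulrA ler_pdivrMr// mulrC ler_pM2l ?ltr0n.
Qed.

(** * A hierarchy of clocks *)

Section Clocks.
Variable t : nat -> nat.
Hypothesis t0 : t 0 = 0%N.
Hypothesis t_gap : forall n, (t n + 2 <= t n.+1)%N.

(** The n such that t n <= k < t n.+1, in a form that increases by at most 1. *)
Fixpoint slow (k : nat) : nat :=
  if k is k'.+1 then
    if k == t (slow k').+1 then (slow k').+1 else slow k'
  else 0%N.

Lemma t_mono : {homo t : n k / (n <= k)%N}.
Proof.
apply: homo_leq => [//|n k l|n]; first exact: leq_trans.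
by have := t_gap n; lia.
Qed.

Lemma t_ge n : (n <= t n)%N.
Proof. by elim: n => [//|n IHn]; have := t_gap n; lia. Qed.

Lemma slow_bounds k : (t (slow k) <= k < t (slow k).+1)%N.
Proof.
elim: k => [|k IHk] /=; first by rewrite t0; have := t_gap 0; lia.
by case: eqP => [->|]; [have := t_gap (slow k).+1|]; lia.
Qed.

Lemma slow_eq n k : (t n <= k < t n.+1)%N -> slow k = n.
Proof.
move=> /andP[nk kn]; have /andP[lk kl] := slow_bounds k.
have [lt|gt|//] := ltngtP (slow k) n.
  by have := leq_trans (t_mono lt) nk; rewrite leqNgt kl.
by have := leq_trans (t_mono gt) lk; rewrite leqNgt kn.
Qed.

(** Clock 0 is real time, and clock j.+1 advances each time that clock j enters
    the next window of t. *)
Definition clock (j k : nat) : nat := iter j slow k.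
Definition moves (j k : nat) : bool := clock j k.+1 != clock j k.

Lemma slow_step k : slow k.+1 = slow k \/ slow k.+1 = (slow k).+1.
Proof. by rewrite [slow k.+1]/=; case: eqP; [right|left]. Qed.

Lemma clock_step j k : clock j k.+1 = (clock j k + moves j k)%N.
Proof.
rewrite /moves; case: eqP => [->|]; first by rewrite addn0.
rewrite addn1; elim: j => [//|j IHj] ne.
have E : clock j k.+1 = (clock j k).+1.
  by apply: IHj => e; apply: ne; rewrite /clock !iterS -!/(clock _ _) e.
move: ne; rewrite /clock !iterS -!/(clock _ _) E.
by case: (slow_step (clock j k)).
Qed.

Lemma moves0 k : moves 0 k.
Proof. by rewrite /moves /clock /= neq_ltn ltnSn orbT. Qed.

Lemma moves_nested i j k : (i <= j)%N -> moves j k -> moves i k.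
Proof.
move=> /subnKC <-; elim: (j - i)%N => [|l IHl]; first by rewrite addn0.
rewrite addnS => mv; apply: IHl; apply: contraNN mv => /eqP e.
by rewrite /clock !iterS -!/(clock _ _) e.
Qed.

(** The time of the step during which clock j goes from n to n.+1. *)
Definition move_time (j n : nat) : nat := iter j (fun n => (t n.+1).-1) n.

Lemma moves_time j k : moves j k -> k = move_time j (clock j k).
Proof.
elim: j => [//|j IHj] mv; have mj := moves_nested (leqnSn j) mv.
rewrite {1}(IHj mj) /move_time iterSr; congr (iter j _ _).
have := clock_step j k; rewrite mj addn1 => E.
move: mv; rewrite /moves /clock !iterS -!/(clock _ _) E [slow _.+1]/=.
by case: (_.+1 =P t _) => [<-//|_]; rewrite eqxx.
Qed.

Lemma move_time_clock j n : clock j (move_time j n) = n /\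
  clock j (move_time j n).+1 = n.+1.
Proof.
elim: j n => [//|j IHj] n.
rewrite /move_time iterSr -/(move_time j _) /clock !iterS -!/(clock _ _).
have [-> ->] := IHj (t n.+1).-1.
have := t_gap n; have := t_gap n.+1; move=> g1 g2.
by split; apply: slow_eq; lia.
Qed.

Lemma move_time_inj j : injective (move_time j).
Proof.
move=> n k e; have [<- _] := move_time_clock j n.
by rewrite e (move_time_clock j k).1.
Qed.

Lemma clock_le j k : (clock j k <= k)%N.
Proof.
elim: j => [//|j IHj]; rewrite /clock iterS -/(clock _ _); apply: leq_trans IHj.
by have /andP[h _] := slow_bounds (clock j k); apply: leq_trans (t_ge _) h.
Qed.

Lemma moves_move_time j n : moves j (move_time j n).
Proof.
rewrite /moves; have [-> ->] := move_time_clock j n.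
by rewrite neq_ltn ltnSn orbT.
Qed.

Lemma not_moves_next j q : ~~ moves j.+1 (move_time j (t q)).
Proof.
have [e1 e2] := move_time_clock j (t q).
rewrite /moves /clock !iterS -!/(clock _ _) e1 e2 negbK.
have g := t_gap q.
by rewrite (@slow_eq q (t q)) ?(@slow_eq q (t q).+1)//; lia.
Qed.

(** By [moves_nested] the clocks that move at time k are the first
    [top_clock N k] ones. *)
Definition top_clock (N k : nat) : nat := find (fun j => ~~ moves j k) (iota 0 N).

Lemma top_clock_bounds N k : (0 < N)%N -> (1 <= top_clock N k <= N)%N.
Proof.
move=> N0; have := find_size (fun j => ~~ moves j k) (iota 0 N).
rewrite size_iota -/(top_clock N k) => ->; rewrite andbT.
by case: N N0 => // N _; rewrite /top_clock /= moves0.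
Qed.

Lemma top_clock_moves N j k : (j < N)%N -> (j < top_clock N k)%N = moves j k.
Proof.
move=> jN; case: ltnP => [jr|rj].
  have := before_find 0%N jr; rewrite nth_iota// add0n.
  by move=> /negbFE ->.
have rN : (top_clock N k < N)%N by exact: leq_ltn_trans jN.
have : has (fun j => ~~ moves j k) (iota 0 N) by rewrite has_find size_iota.
move=> /(nth_find 0%N); rewrite -/(top_clock N k) nth_iota// add0n => nm.
by apply/esym/negbTE/negP => mv; move: nm; rewrite (moves_nested rj mv).
Qed.

(** Clock j advances and clock j.+1 does not when clock j leaves the beginning
    of a window, because every window has length at least 2. *)
Lemma top_clock_io N j K : (1 <= j <= N)%N ->
  exists2 k, (K <= k)%N & top_clock N k = j.
Proof.
case: j => // j jN; exists (move_time j (t K)).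
  apply: leq_trans (t_ge K) _.
  by have [e _] := move_time_clock j (t K); rewrite -{1}e clock_le.
apply/eqP; rewrite eqn_leq top_clock_moves ?moves_move_time ?andbT; last by lia.
have [jN'|Nj] := ltnP j.+1 N.
  by rewrite leqNgt top_clock_moves//; exact: not_moves_next.
have N0 : (0 < N)%N by exact: leq_ltn_trans jN.
by apply: leq_trans Nj; case/andP: (top_clock_bounds (move_time j (t K)) N0).
Qed.

(** Suppose that the j-th property holds at some time of every late enough window,
    time being read on clock j. Start from a late value n of the slowest clock.
    The n-th window of the clock below it contains a time at which its property
    holds, this time is the index of a window of the next clock, and so on
    down to real time. *)
Lemma common_zero (N : nat) (Z : nat -> nat -> Prop) :
  (forall j, (j < N)%N -> exists n0, forall n, (n0 <= n)%N ->
     exists2 a, (t n <= a < t n.+1)%N & Z j a) ->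
  forall K, exists2 k, (K <= k)%N & forall j, (j < N)%N -> Z j (clock j k).
Proof.
move=> HZ K.
suff [n1 H] : exists n1, forall n, (n1 <= n)%N ->
    exists k, [/\ (n <= k)%N, clock N k = n & forall j, (j < N)%N -> Z j (clock j k)].
  have [k [kn _ kZ]] := H (maxn n1 K) (leq_maxl _ _).
  by exists k => //; apply: leq_trans kn; exact: leq_maxr.
elim: N HZ => [|j IHj] HZ; first by exists 0%N => n _; exists n.
have [n1 H1] := IHj (fun i ij => HZ i (ltnW ij)).
have [n0 H0] := HZ j (ltnSn j).
exists (maxn n0 n1) => n; rewrite geq_max => /andP[n0n n1n].
have [a an Za] := H0 n n0n.
have na : (n <= a)%N by apply: leq_trans (t_ge n) _; case/andP: an.
have [k [ak ck Zk]] := H1 a (leq_trans n1n na).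
exists k; split; first exact: leq_trans ak.
  by rewrite /clock iterS -/(clock j k) ck; exact: slow_eq.
move=> i; rewrite ltnS leq_eqVlt => /predU1P[->|/Zk//].
by rewrite ck.
Qed.

End Clocks.

(** * The recurrent walk *)

Section Construction.
Context (R : realType) (N : nat) (dim : nat -> nat).
Hypothesis N_gt0 : (1 <= N)%N.
Hypothesis dim_incr : forall j, (1 <= j < N)%N -> (dim j < dim j.+1)%N.
Hypothesis dim1 : (dim 1 <= 2)%N.
Hypothesis gaps : forall j, (1 <= j < N)%N -> (dim j.+1 - dim j <= 2)%N.

Local Notation m := (dim N).

Definition group_low (j : nat) : nat := if j is 0 then 0 else dim j.

(** Group j consists of the coordinates that move in the steps of dimension
    dim j.+1 and above, but not below; the groups are moved by the clocks. *)
Definition coord_group (j : nat) : seq 'I_m :=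
  [seq i : 'I_m <- enum 'I_m | (group_low j <= i < dim j.+1)%N].

Lemma coord_group_uniq j : uniq (coord_group j).
Proof. by apply: filter_uniq; exact: enum_uniq. Qed.

Lemma mem_coord_group j (i : 'I_m) :
  (i \in coord_group j) = (group_low j <= i < dim j.+1)%N.
Proof. by rewrite mem_filter mem_enum andbT. Qed.

Lemma coord_group_size j : (j < N)%N -> (size (coord_group j) <= 2)%N.
Proof.
move=> jN; apply: (@leq_trans (dim j.+1 - group_low j)).
  rewrite -(size_map val) -(size_iota (group_low j) (_ - _)).
  apply: uniq_leq_size.
    by rewrite map_inj_uniq ?coord_group_uniq//; exact: val_inj.
  move=> _ /mapP[i + ->]; rewrite mem_coord_group mem_iota => /andP[ji ij].
  by rewrite ji /= subnKC// (leq_trans ji)// ltnW.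
case: j jN => [|j] jN; first by rewrite subn0.
by apply: gaps.
Qed.

Lemma coord_group_cover (i : 'I_m) : exists2 j, (j < N)%N & i \in coord_group j.
Proof.
have ex : exists j, (i < dim j.+1)%N by exists N.-1; rewrite prednK.
case: (ex_minnP ex) => j ij jmin.
have jN : (j < N)%N.
  by have := jmin N.-1; rewrite prednK// => /(_ (ltn_ord i)); lia.
exists j => //; rewrite mem_coord_group ij andbT.
case: j ij jmin jN => // j ij jmin jN.
by rewrite leqNgt; apply/negP => /jmin; rewrite ltnn.
Qed.

Lemma lt_dim_coord_group j (i : 'I_m) r :
  (j < N)%N -> (1 <= r <= N)%N -> i \in coord_group j ->
  (i < dim r)%N = (j < r)%N.
Proof.
move=> jN /andP[r1 rN]; rewrite mem_coord_group => /andP[ji ij].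
case: (ltnP j r) => [jr|rj].
  by apply: leq_trans ij _; apply: (dim_mono dim_incr) => //; rewrite ltnS.
apply/negP => ir; have j0 : (0 < j)%N by exact: leq_trans rj.
have := @dim_mono N dim dim_incr r j; rewrite r1 rj (ltnW jN) => /(_ isT isT) drj.
move: ji; rewrite leqNgt => /negP; apply; case: j j0 {ij jN rj} drj => // j _ drj.
exact: leq_trans drj.
Qed.

Context (d : measure_display) (T : measurableType d) (P : probability T R).
Variable c : nat -> T -> bool.
Hypothesis mc : forall n, discrete (c n).
Hypothesis c_indep : forall J, uniq J -> indep_on P c J.
Hypothesis c_fair : forall n b, pr P (c n @^-1` [set b]) = 2^-1.

Local Notation signs := (@signs d T c m).

Variable t : nat -> nat.
Hypothesis t0 : t 0 = 0%N.
Hypothesis t_gap : forall n, (t n + 2 <= t n.+1)%N.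
Hypothesis t_return : forall n (C : seq 'I_m) (J : seq nat), (0 < n)%N ->
  uniq C -> (size C <= 2)%N -> uniq J -> size J = (t n.+1).-1 ->
  pr P [set w | avoids (null_on C) (t n) (map (signs^~ w) J)] <= 2^-1 ^+ n.

Definition step_dim (k : nat) : nat := dim (top_clock t N k).

Lemma step_dim_le k : (step_dim k <= m)%N.
Proof.
have /andP[r1 rN] := top_clock_bounds t k N_gt0.
by apply: (dim_mono dim_incr); rewrite ?r1.
Qed.

Definition project (k : nat) (v : lattice m) : lattice m :=
  first_coords m (first_coords (step_dim k) v).

Definition ladder_position (k : nat) (w : T) : lattice m :=
  \row_i \sum_(l <- iota 0 k) project l (signs l w) 0 i.

Lemma discrete_ladder_position k : discrete (ladder_position k).
Proof.
have mX := discrete_map (iota 0 k) (discrete_signs (m := m) mc).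
have := discrete_comp (fun s : seq 'rV[int]_m => \row_i
  \sum_(l <- iota 0 k) project l (nth 0 s l) 0 i : lattice m) mX.
congr discrete; apply/funext => w /=; apply/rowP => i; rewrite !mxE.
apply: eq_big_seq => l; rewrite mem_iota add0n => lk.
by rewrite (nth_map 0%N) ?size_iota// nth_iota.
Qed.

Definition ladder_walk (k : nat) : {RV P >-> lattice m} :=
  rv_of P (discrete_ladder_position k).

Lemma increment_ladder_walk k w : increment ladder_walk k w = project k (signs k w).
Proof.
rewrite /increment; apply/rowP => i.
rewrite [LHS]mxE [X in _ + X]mxE.
rewrite [ladder_walk k.+1 w]/(ladder_position k.+1 w).
rewrite [ladder_walk k w]/(ladder_position k w) ![ladder_position _ _ _ _]mxE.
rewrite -[k.+1]addn1 iotaD big_cat /= big_seq1 add0n.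
by rewrite addrAC subrr add0r.
Qed.

Lemma ladder_walk_is_walk :
  walk_in_varying_dimension (sign_law P m mc) step_dim ladder_walk.
Proof.
split.
- by move=> w; apply/rowP => i; rewrite [LHS]mxE [RHS]mxE big_nil.
- move=> J A uJ mA.
  have E k : increment ladder_walk k @^-1` A k =
      signs k @^-1` [set v | A k (project k v)].
    by apply/funext => w; rewrite /preimage /= increment_ladder_walk.
  have mB k : measurable (increment ladder_walk k @^-1` A k).
    by rewrite E; exact: discrete_signs.
  rewrite prod_pr// (prE P); last first.
    by apply: bigcap_measurableType => k _.
  congr EFin.
  have := signs_indep mc c_indep uJ (fun k => [set v | A k (project k v)]).
  rewrite prT mul1r setTI => H.
  under eq_bigr do rewrite E.
  rewrite -H; congr pr; apply/seteqP; split=> w Hw k kJ; have := Hw k kJ;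
    by rewrite /preimage /= increment_ladder_walk.
- move=> k A; rewrite /pushforward.
  rewrite (_ : increment ladder_walk k @^-1` A =
      signs k @^-1` [set v | A (project k v)]); last first.
    by apply/funext => w; rewrite /preimage /= increment_ladder_walk.
  rewrite sign_lawE -[RHS]/(P (signs 0 @^-1` [set v | A (project k v)])).
  rewrite !(prE P (discrete_signs mc _ _)); congr EFin.
  exact: signs_law.
Qed.

Lemma ladder_walk_interlaces : interlaces N dim step_dim ladder_walk.
Proof.
split.
- move=> k; apply: truly_dimensional_signs => v A sv Av.
  pose v' : lattice m :=
    \row_i oapp (fun j : 'I_(step_dim k) => v 0 j) 1 (insub (val i)).
  have v'E : first_coords (step_dim k) (project k v') = v.
    apply/rowP => i.
    have im : (i < m)%N by exact: leq_trans (ltn_ord i) (step_dim_le k).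
    rewrite (@first_coordsE _ _ _ i (Ordinal im))//.
    by rewrite projection_entry /= ltn_ord mxE /= valK.
  have sv' i : v' 0 i = 1 \/ v' 0 i = -1.
    by rewrite mxE; case: insubP => [j _ _|_] /=; [exact: sv|left].
  have := pr_signs_gt0 mc c_indep c_fair k sv'.
  set B := (_ @^-1` _) => B0 muA.
  have mB : measurable B by exact: discrete_signs.
  have : (P B <= 0)%E.
    rewrite -muA /pushforward; apply: le_measure; rewrite ?inE//.
      rewrite (_ : _ @^-1` _ = signs k @^-1`
          [set z | A (first_coords (step_dim k) (project k z))]).
        exact: discrete_signs.
      by apply/funext => w; rewrite /preimage /= increment_ladder_walk.
    by move=> w /= e; rewrite increment_ladder_walk e /project v'E.
  by rewrite (prE P mB) lee_fin leNgt B0.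
- by move=> k; exists (top_clock t N k) => //; exact: top_clock_bounds.
- move=> j jN; apply/infinite_natP => K.
  have [k Kk e] := top_clock_io t0 t_gap K jN.
  by exists k => //=; rewrite /step_dim e.
Qed.

Definition group_at_zero j n : set T :=
  [set w | null_on (coord_group j)
    (map (signs^~ w) (map (move_time t j) (iota 0 n)))].

(** Seen in the time of clock j, the coordinates of group j form an ordinary
    walk, which takes its n-th step at real time [move_time t j n]. *)
Lemma walk_coord_group j k w i : (j < N)%N -> i \in coord_group j ->
  ladder_position k w 0 i =
  \sum_(n <- iota 0 (clock t j k)) signs (move_time t j n) w 0 i.
Proof.
move=> jN ij; elim: k => [|k IHk].
  have : (clock t j 0 <= 0)%N := clock_le t0 t_gap j 0.
  by rewrite leqn0 => /eqP ->; rewrite mxE !big_nil.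
have -> : ladder_position k.+1 w 0 i =
    ladder_position k w 0 i + project k (signs k w) 0 i.
  rewrite [LHS]mxE [ladder_position k w _ _]mxE.
  by rewrite -[k.+1]addn1 iotaD big_cat /= big_seq1 add0n.
rewrite IHk clock_step iotaD big_cat /= add0n projection_entry.
rewrite /step_dim (lt_dim_coord_group jN (top_clock_bounds t k N_gt0) ij).
rewrite top_clock_moves//.
congr (_ + _); case mv : (moves t j k); last by rewrite big_nil.
by rewrite big_seq1 -(moves_time mv).
Qed.

(** The probability that group j misses 0 during its n-th window is at most
    2^-n, so almost surely each group visits 0 in all windows from some point
    on, and [common_zero] applies. The groups need not be independent. *)
Lemma ladder_walk_recurrent : recurrent ladder_walk.
Proof.
pose J j n := map (move_time t j) (iota 0 (t n.+1).-1).
have uJ j n : uniq (J j n).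
  by rewrite map_inj_uniq ?iota_uniq//; exact: move_time_inj.
pose bad j n := if (0 < n)%N then
    [set w | avoids (null_on (coord_group j)) (t n) (map (signs^~ w) (J j n))]
  else set0.
have mbad j n : measurable (bad j n).
  rewrite /bad; case: ifP => // _.
  exact: (measurable_event (discrete_signs mc) _ (J j n)).
have sum_bad j n : (j < N)%N -> \sum_(i < n) pr P (bad j i) <= 2.
  move=> jN; have le i : pr P (bad j i) <= 2^-1 ^+ i.
    rewrite /bad; case: ifP => [i0|_]; last by rewrite pr0 exprn_ge0.
    apply: t_return => //; [exact: coord_group_uniq|exact: coord_group_size|].
    by rewrite size_map size_iota.
  apply: le_trans (ler_sum _ (fun (i : 'I_n) _ => le i)) _.
  suff -> : \sum_(i < n) 2^-1 ^+ i = 2 * (1 - 2^-1 ^+ n) :> R.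
    by rewrite ler_piMr// lerBlDr lerDl exprn_ge0.
  elim: n => [|n IHn]; first by rewrite big_ord0 expr0 subrr mulr0.
  by rewrite big_ord_recr /= IHn exprS; lra.
have neg j : (j < N)%N -> P.-negligible [set w | infinite_set [set n | bad j n w]].
  by move=> jN; apply: (borel_cantelli_ae (mbad j) (fun n => sum_bad j n jN)).
pose E j := if (j < N)%N then [set w | infinite_set [set n | bad j n w]] else set0.
have negE : P.-negligible (\bigcup_j E j).
  apply: negligible_bigcup => j; rewrite /E; case: ifP => [/neg//|_].
  exact: negligible_set0.
apply: negligibleS negE => w /= notinf; apply: contrapT => notE.
apply: notinf.
have good j : (j < N)%N -> exists n0, forall n, (n0 <= n)%N -> ~ bad j n w.
  move=> jN; apply: contrapT => no; apply: notE; exists j => //.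
  rewrite /E jN; apply/infinite_natP => n.
  apply: contrapT => nob; apply: no; exists n => l nl bl.
  by apply: nob; exists l.
apply/infinite_natP => K.
have [|k Kk Zk] := @common_zero t t0 t_gap N (fun j a => group_at_zero j a w) _ K.
  move=> j jN; have [n0 Hn0] := good j jN; exists n0.+1 => n n0n.
  have := Hn0 n (ltnW n0n); rewrite /bad (leq_trans _ n0n)// => nav.
  apply: contrapT => noa; apply: nav => a.
  rewrite !size_map size_iota => /andP[na an] za; apply: noa; exists a.
    by rewrite na /=; have := t_gap n; lia.
  by move: za; rewrite -!map_take take_iota (minn_idPl an).
exists k => //=; apply/rowP => i; have [j jN ij] := coord_group_cover i.
rewrite [RHS]mxE; transitivity (ladder_position k w 0 i); first by [].
rewrite (walk_coord_group k w jN ij).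
by have := Zk j jN i ij; rewrite !big_map.
Qed.

End Construction.

(** The windows are chosen one after the other. The 2L + 1 times at which
    [return_window] looks for a return, from t n to t n + 2L, make up the n-th
    window; as L > 0, its length is at least 2. *)
Lemma return_times (R : realType) : exists t : nat -> nat,
  [/\ t 0 = 0%N, forall n, (t n + 2 <= t n.+1)%N &
   forall (d : measure_display) (T : measurableType d)
    (P : probability T R) (c : nat -> T -> bool) (m : nat),
   (forall n, discrete (c n)) -> (forall J, uniq J -> indep_on P c J) ->
   (forall n b, pr P (c n @^-1` [set b]) = 2^-1) ->
   forall n (C : seq 'I_m) (J : seq nat), (0 < n)%N ->
   uniq C -> (size C <= 2)%N -> uniq J -> size J = (t n.+1).-1 ->
   pr P [set w | avoids (null_on C) (t n) (map ((signs c m)^~ w) J)] <= 2^-1 ^+ n].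
Proof.
pose ok n s L := (0 < s)%N -> forall (d : measure_display)
    (T : measurableType d) (P : probability T R) (c : nat -> T -> bool) (m : nat)
    (C : seq 'I_m) (J : seq nat),
    (forall n, discrete (c n)) -> (forall J, uniq J -> indep_on P c J) ->
    (forall n b, pr P (c n @^-1` [set b]) = 2^-1) ->
    uniq C -> (size C <= 2)%N -> uniq J -> size J = (s + L.*2)%N ->
    pr P [set w | avoids (null_on C) s (map ((signs c m)^~ w) J)] <= 2^-1 ^+ n.
have okP n s : exists L, (0 < L)%N /\ ok n s L.
  have [s0|s0] := posnP s; first by exists 1%N; rewrite /ok s0.
  have e0 : 0 < 2^-1 ^+ n :> R by rewrite exprn_gt0.
  by have [L L0 HL] := return_window s0 e0; exists L; split=> // _.
pose L n s := projT1 (cid (okP n s)).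
have LP n s : (0 < L n s)%N /\ ok n s (L n s) := projT2 (cid (okP n s)).
pose t := fix t n := if n is n'.+1 then (t n' + (L n' (t n')).*2.+1)%N else 0%N.
have tS n : t n.+1 = (t n + (L n (t n)).*2.+1)%N by [].
exists t; split=> // [n|d T P c m mc ic fc n C J n0 uC C2 uJ sJ].
  by rewrite tS; have [L0 _] := LP n (t n); lia.
apply: (LP n (t n)).2 => //; last by rewrite sJ tS; lia.
by case: n n0 {sJ} => // n _; rewrite tS; lia.
Qed.

(** The first group has dim 1 <= 2 coordinates and the others at most as many as
    the gaps allow, so that every group is a recurrent walk in its own
    clock. *)
Lemma small_gaps_recurrent (R : realType) (N : nat) (dim : nat -> nat) :
  (1 <= N)%N -> (forall j, (1 <= j < N)%N -> (dim j < dim j.+1)%N) ->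
  (dim 1 <= 2)%N -> (\max_(1 <= j < N) (dim j.+1 - dim j) <= 2)%N ->
  exists (d : measure_display) (T : measurableType d) (P : probability T R)
     (F : probability (lattice (dim N)) R) (D : nat -> nat)
     (S : nat -> {RV P >-> lattice (dim N)}),
     [/\ step_distribution F, walk_in_varying_dimension F D S,
         interlaces N dim D S & recurrent S].
Proof.
move=> N0 dim_incr dim1 gaps.
have gap j : (1 <= j < N)%N -> (dim j.+1 - dim j <= 2)%N.
  move=> jN; apply: leq_trans gaps.
  by apply: (leq_bigmax_seq (F := fun j => (dim j.+1 - dim j)%N)) => //;
    rewrite mem_index_iota.
have [t [t0 tg tr]] := return_times R.
have mc := @discrete_coin R; have ic := @coin_indep R; have fc := @pr_coin R.
pose P : probability _ R := @unit_prob R.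
exists _, _, P.
exists (sign_law P (dim N) mc), (step_dim N dim t), (ladder_walk N dim P mc t).
split.
- exact: sign_law_step.
- exact: ladder_walk_is_walk.
- exact: ladder_walk_interlaces.
- by apply: ladder_walk_recurrent => //; exact: tr.
Qed.

(** * Recurrence and transience *)

Theorem corollary2p3 (R : realType) (N : nat) (dim : nat -> nat)
    (N_gt0 : (1 <= N)%N)
    (dim_gt0 : forall j, (1 <= j <= N)%N -> (0 < dim j)%N)
    (dim_incr : forall j, (1 <= j < N)%N -> (dim j < dim j.+1)%N) :
  ((dim 1%N <= 2)%N ->
   (\max_(1 <= j < N) (dim j.+1 - dim j) <= 2)%N ->
   exists (d : measure_display) (T : measurableType d) (P : probability T R)
     (F : probability (lattice (dim N)) R) (D : nat -> nat)
     (S : nat -> {RV P >-> lattice (dim N)}),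
     [/\ step_distribution F, walk_in_varying_dimension F D S,
         interlaces N dim D S & recurrent S])
  /\
  (~ (\max_(1 <= j < N) (dim j.+1 - dim j) <= 2)%N ->
   forall (d : measure_display) (T : measurableType d) (P : probability T R)
     (F : probability (lattice (dim N)) R) (D : nat -> nat)
     (S : nat -> {RV P >-> lattice (dim N)}),
     step_distribution F -> walk_in_varying_dimension F D S ->
     interlaces N dim D S -> transient S).
Proof.
split=> [dim1 gaps|gap d T P F D S].
  exact: small_gaps_recurrent.
exact: large_gap_transient.
Qed.
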